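(* Consider the Best-of-two on the stochastic block model $G(2n,p,q)$, where $p$ and $q$ are positive constants. If $\frac qp>\sqrt5-2$, then $G(2n,p,q)$ w.h.p. satisfies the following property: there exist two positive constants $C,C'>0$ such that $$\forall A\subseteq V:\quad \Pr\left[T_{\mathrm{cons}}(A)\le C\log n\right]\ge 1-O(n^{-C'}).$$
   Context: Stochastic block model: for $n\in\mathbb N$ and $p,q\in[0,1]$ with $q\le p$, $G(2n,p,q)$ is the random graph on $V=V_1\cup V_2$, $|V_1|=|V_2|=n$, $V_1\cap V_2=\emptyset$, in which each pair of distinct vertices $u\in V_i$, $v\in V_j$ forms an edge independently with probability $p$ if $i=j$ and $q$ if $i\ne j$. Best-of-two: each vertex of a graph $G=(V,E)$ holds an opinion in $\{1,2\}$. In each synchronous discrete step, every vertex independently samples two uniformly random neighbors (with replacement) and, if both hold the same opinion, adopts it; otherwise it keeps its own opinion. If $A$ is the set of vertices with opinion 1, $A'$ denotes the set of vertices with opinion 1 after one step. The graph is generated first and then kept fixed; then an initial set $A^{(0)}=A$ is chosen and $A^{(t+1)}=(A^{(t)})'$. The consensus time is $T_{\mathrm{cons}}(A)=\min\{t\ge0: A^{(t)}\in\{\emptyset,V\},\ A^{(0)}=A\}$. In the displayed inequality $\Pr$ is over the voting process on the fixed graph; ''w.h.p.'' refers to the random graph. Asymptotics are as $n\to\infty$. ''W.h.p.'' means with probability at least $1-n^{-c}$ for some constant $c>0$. ''Constant'' means independent of $n$. *)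

(* Defs.v *)
From mathcomp Require Import all_boot all_order all_algebra.
From mathcomp Require Import all_classical all_reals all_analysis.

Set Implicit Arguments.
Unset Strict Implicit.
Unset Printing Implicit Defensive.

Import Order.TTheory GRing.Theory Num.Theory.

Local Open Scope ring_scope.

(* A simple graph on V is represented by its edge set, a set of two-element
   subsets of V. *)
Definition graph (V : finType) := {set {set V}}.

Definition vertex_pairs (V : finType) : {set {set V}} :=
  [set e : {set V} | #|e| == 2%N]%SET.

Definition neighbors (V : finType) (G : graph V) (v : V) : {set V} :=
  [set w | (w != v) && ([set v; w]%SET \in G)]%SET.

(* The first component of a vertex is its block: V_1 = {true} x 'I_n and
   V_2 = {false} x 'I_n. *)
Definition vertex (n : nat) : finType := (bool * 'I_n)%type.

Section StochasticBlockModel.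
Variables (R : realType) (n : nat) (p q : R).

Definition edge_pr (e : {set vertex n}) : R :=
  if [forall u in e, forall v in e, u.1 == v.1] then p else q.

Definition sbm_weight (G : graph (vertex n)) : R :=
  \prod_(e in vertex_pairs (vertex n))
     (if e \in G then edge_pr e else 1 - edge_pr e).

Definition sbm_pr (Q : graph (vertex n) -> Prop) : R :=
  \sum_(G : graph (vertex n) | (G \subset vertex_pairs (vertex n)) && `[< Q G >])
     sbm_weight G.

End StochasticBlockModel.

Section BestOfTwo.
Variables (R : realType) (V : finType).
Implicit Types (G : graph V) (A : {set V}).

(* An isolated vertex has no neighbor to sample: by convention it samples
   itself, and hence keeps its opinion. *)
Definition sampling_set G (v : V) : {set V} :=
  if neighbors G v == finset.set0 then [set v]%SET else neighbors G v.

Definition neighbor_pr G (v w : V) : R :=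
  (w \in sampling_set G v)%:R / #|sampling_set G v|%:R.

(* A set A of vertices stands for the configuration in which A is the set of
   vertices with opinion 1; s v is the pair of vertices sampled by v. *)
Definition vote A (s : V -> V * V) : {set V} :=
  [set v | if ((s v).1 \in A) == ((s v).2 \in A) then (s v).1 \in A
           else v \in A]%SET.

(* s t is the family of samples used in the step from time t to time t + 1. *)
Definition opinions A (s : nat -> V -> V * V) (t : nat) : {set V} :=
  iteri t (fun i B => vote B (s i)) A.

Definition consensus A : Prop := A = finset.set0 \/ A = finset.setT.

(* The infimum is a minimum when consensus is reached, and +oo otherwise. *)
Definition consensus_time A (s : nat -> V -> V * V) : \bar R :=
  ereal_inf [set t%:R%:E | t in [set t | consensus (opinions A s t)]]%classic.

(* The family S is a realization, on the probability space (Omega, P), of the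
   samples of all steps and all vertices: the two samples of v at time t are
   uniform on the neighbors of v, and all samples are mutually independent
   (over the steps, over the vertices, and within a pair).  This is expressed
   through the finite-dimensional laws, which determine the law of S. *)
Definition best_of_two_samples G (d : measure_display)
    (Omega : measurableType d) (P : probability Omega R)
    (S : Omega -> nat -> V -> V * V) : Prop :=
  (forall t v x, measurable [set w : Omega | S w t v = x]%classic) /\
  (forall (T : nat) (s : nat -> V -> V * V),
     P [set w | forall t v, (t < T)%N -> S w t v = s t v]%classic =
     (\prod_(t < T) \prod_(v : V)
        (neighbor_pr G v (s t v).1 * neighbor_pr G v (s t v).2))%:E).

End BestOfTwo.

(* Main.v *)
Require Import Defs.
From mathcomp Require Import all_boot all_order all_algebra.
From mathcomp Require Import all_classical all_reals all_analysis.
From mathcomp Require Import ring lra.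

(** Write V_1, V_2 for the blocks, s = (|A| - n) / n for the bias and
    m = (|A :&: V_1| - |A :&: V_2|) / n for the disparity of a configuration A,
    and w = (p - q) / (p + q).

    If every vertex saw exactly the expected fraction of opinion 1 among its
    neighbors, one step would send (s, m) to
      s' = s (3 - s^2 - (w^2 + 2 w) m^2) / 2,
      m' = m ((1 + 2 w) (1 - s^2) - w^2 m^2) / 2.
    Besides consensus and the origin this map may have fixed points with s = 0,
    m^2 = (2 w - 1) / w^2; there the bias is multiplied by 1 / w - w.  Such a
    point is unstable exactly when w^2 + w < 1, which is the hypothesis
    q / p > sqrt 5 - 2.  The number 1 - w - w^2 is called the gap.

    The proof exhibits one function of the configuration, the potential, that
    vanishes exactly at consensus, lies between 1 / n and O(n) elsewhere, and
    satisfies E[potential (A')] <= (1 - b) potential (A) for every A, with a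
    constant b > 0 ([step_potential_le]).  After C log n steps its expectation
    is O(n^-2), and Markov's inequality gives consensus.

    The potential has the following shape.  The disparity always falls into the
    trap m^2 <= (1 + w) / (2 + w), and never leaves it again
    ([drift_diff_le], [trap_stable]); outside the trap the potential is larger
    than inside and decreases with |m|.  Inside the trap,
    (1 + kappa m^2) / s^2 - 1 is a strict Lyapunov function of the mean-field map
    ([lyapunov_decrease]).  It blows up at s = 0, where the noise of order
    n^(-1/2) matters, so it is cut off at a small multiple of n.

    Four regimes remain.  Outside the trap and in the middle regime, Hoeffding's
    inequality makes the noise negligible against the deterministic decrease
    ([contract_outside], [contract_middle]).  Where the potential is cut off,
    |s| is O(n^(-1/2)), and the noise alone carries |s| beyond any given multiple
    of n^(-1/2) with constant probability; this anticoncentration follows from a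
    change of measure ([bern_anticoncentration], [contract_core]).  Close to
    consensus the minority shrinks on average by a constant factor, since a
    vertex adopts a rare opinion only if it samples it twice or already holds it
    ([contract_end]).

    What is needed from the graph is only that degrees are of order n and that,
    simultaneously for all A, the vertices see the expected fraction of A up to
    O(n^(-1/2)) on average ([good_graph]).  A union bound over the sets A and
    over the signs of the errors proves both ([good_graph_pr]).  The errors shift
    s' by O(n^(-1/2)) in an adversarial direction; as the anticoncentration
    reaches any multiple of n^(-1/2), this does no harm. *)

Set Implicit Arguments.
Unset Strict Implicit.
Unset Printing Implicit Defensive.

Import Order.TTheory GRing.Theory Num.Theory.

Local Open Scope ring_scope.

(** * Product Bernoulli measures on subsets *)

Lemma expRN_le_inv (R : realType) (y : R) : 0 < y -> expR (- y) <= y^-1.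
Proof.
move=> y0; rewrite expRN lef_pV2 ?posrE ?expR_gt0 //.
by apply: le_trans (expR_ge1Dx _); rewrite lerDr.
Qed.

Lemma expRN_cube_le (R : realType) (y : R) : 0 < y -> expR (- y) <= 6 / y ^+ 3.
Proof.
move=> y0; rewrite expRN -[6 / _]invf_div lef_pV2 ?posrE ?expR_gt0 ?divr_gt0 ?exprn_gt0 //.
by apply: le_trans (expR_ge1Dxn 2 (ltW y0)); rewrite lerDr.
Qed.

Section Bernoulli.
Variables (R : realType) (I : finType).
Implicit Types (P : I -> R) (f g : {set I} -> R) (B : {set I}).

Definition bern_weight P B : R := \prod_i (if i \in B then P i else 1 - P i).

Definition bern_exp P f : R := \sum_(B : {set I}) bern_weight P B * f B.

Definition bern_pr P (E : pred {set I}) : R := bern_exp P (fun B => (E B)%:R).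

(** Independence of the coordinates. *)
Lemma bern_expM P (h : I -> bool -> R) :
  bern_exp P (fun B => \prod_i h i (i \in B)) =
  \prod_i (P i * h i true + (1 - P i) * h i false).
Proof.
rewrite bigA_distr /bern_exp; apply: eq_bigr => B _.
rewrite /bern_weight -big_split /=; apply: eq_bigr => i _.
by case: (i \in B).
Qed.

Lemma bern_exp_cst P a : bern_exp P (fun=> a) = a.
Proof.
rewrite /bern_exp -mulr_suml (_ : \sum_B _ = 1) ?mul1r //.
transitivity (bern_exp P (fun B => \prod_(i : I) 1)).
  by apply: eq_bigr => B _; rewrite big1 // mulr1.
rewrite (bern_expM P (fun _ _ => 1)) big1 // => i _.
by rewrite !mulr1 addrC subrK.
Qed.

Lemma bern_expD P f g :
  bern_exp P (fun B => f B + g B) = bern_exp P f + bern_exp P g.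
Proof. by rewrite /bern_exp -big_split; apply: eq_bigr => B _; rewrite mulrDr. Qed.

Lemma bern_expZ P a f : bern_exp P (fun B => a * f B) = a * bern_exp P f.
Proof. by rewrite /bern_exp mulr_sumr; apply: eq_bigr => B _; rewrite mulrCA. Qed.

Lemma bern_exp_sum P (J : Type) (r : seq J) (Q : pred J) (F : J -> {set I} -> R) :
  bern_exp P (fun B => \sum_(j <- r | Q j) F j B) =
  \sum_(j <- r | Q j) bern_exp P (F j).
Proof.
rewrite /bern_exp exchange_big /=; apply: eq_bigr => B _.
by rewrite mulr_sumr.
Qed.

Section Chances.
Variable P : I -> R.
Hypothesis P01 : forall i, 0 <= P i <= 1.

Lemma bern_weight_ge0 B : 0 <= bern_weight P B.
Proof.
apply: prodr_ge0 => i _; have /andP[P0 P1] := P01 i.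
by case: ifP; rewrite ?subr_ge0.
Qed.

Lemma le_bern_exp f g : (forall B, f B <= g B) -> bern_exp P f <= bern_exp P g.
Proof. by move=> fg; apply: ler_sum => B _; rewrite ler_wpM2l ?bern_weight_ge0. Qed.

Lemma le_bern_pr (E F : pred {set I}) :
  (forall B, E B -> F B) -> bern_pr P E <= bern_pr P F.
Proof.
move=> EF; apply: le_bern_exp => B; rewrite ler_nat.
by case: (E B) (EF B) => // ->.
Qed.

Lemma bern_prC (E : pred {set I}) : bern_pr P (predC E) = 1 - bern_pr P E.
Proof.
apply/eqP; rewrite eq_sym subr_eq -bern_expD; apply/eqP.
rewrite -[LHS](bern_exp_cst P); apply: eq_bigr => B _ /=.
by case: (E B); rewrite ?addr0 ?add0r.
Qed.

Lemma bern_pr_in i : bern_pr P (fun B => i \in B) = P i.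
Proof.
pose h j b : R := if j == i then (b : bool)%:R else 1.
have hE B : ((i \in B)%:R : R) = \prod_j h j (j \in B).
  rewrite (bigD1 i) //= big1 /h ?eqxx ?mulr1 // => j /negbTE -> //.
rewrite /bern_pr /bern_exp; under eq_bigr do rewrite hE.
rewrite -/(bern_exp P (fun B => \prod_j h j (j \in B))) bern_expM.
rewrite (bigD1 i) //= big1 /h ?eqxx /= ?mulr1 ?mulr0 ?addr0 // => j /negbTE ->.
by rewrite !mulr1 addrC subrK.
Qed.

(** The linear term disappears on averaging a centered variable, so this bound
    turns into a sub-Gaussian moment generating function. *)
Lemma expR_le_add_sqr (x : R) : expR x <= x + expR (2 * x ^+ 2).
Proof.
(* Below 1 / 2, compare with the inverse of 1 - x; above, x is at most
   2 x^2. *)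
have [x2|x2] := leP x (1 / 2); last first.
  have h : expR x <= expR (2 * x ^+ 2) by rewrite ler_expR; nra.
  by lra.
have h1 : expR x <= (1 - x)^-1.
  rewrite -[x]opprK expRN opprK lef_pV2 ?posrE ?expR_gt0 //; last by lra.
  exact: expR_ge1Dx.
apply: (le_trans h1); apply: (@le_trans _ _ (x + (1 + 2 * x ^+ 2))); last first.
  by rewrite lerD2l expR_ge1Dx.
by rewrite -[leLHS]mul1r ler_pdivrMr; nra.
Qed.

Lemma bern_mgf (x : R) (i : I) :
  P i * expR (x * (1 - P i)) + (1 - P i) * expR (x * (0 - P i))
    <= expR (2 * x ^+ 2).
Proof.
have /andP[P0 P1] := P01 i.
have h1 (y : R) : y ^+ 2 <= 1 ->
    expR (x * y) <= x * y + expR (2 * x ^+ 2).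
  move=> y1; apply: (le_trans (expR_le_add_sqr _)); rewrite lerD2l ler_expR.
  rewrite exprMn ler_wpM2l //; have := sqr_ge0 x; nra.
have a1 := h1 (1 - P i) ltac:(nra).
have a2 := h1 (0 - P i) ltac:(nra).
have := ler_wpM2l P0 a1.
have P1' : 0 <= 1 - P i by lra.
have := ler_wpM2l P1' a2.
nra.
Qed.

Definition bern_dev (c : I -> R) (B : {set I}) : R :=
  \sum_i c i * ((i \in B)%:R - P i).

(** Chernoff's method with the exponential weight [t / (4 Q)]. *)
Lemma hoeffding (c : I -> R) (Q t : R) : 0 < Q -> 0 <= t ->
  \sum_i c i ^+ 2 <= Q ->
  bern_pr P (fun B => t <= bern_dev c B) <= expR (- (t ^+ 2 / (8 * Q))).
Proof.
move=> Q0 t0 cQ; pose l := t / (4 * Q).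
have l0 : 0 <= l by rewrite divr_ge0 //; lra.
apply: (@le_trans _ _ (bern_exp P
    (fun B => expR (- (l * t)) * \prod_i expR (l * c i * ((i \in B)%:R - P i))))).
  apply: le_bern_exp => B; rewrite -expR_sum -expRD.
  case: (leP t) => tB /=; last by rewrite expR_ge0.
  apply: le_trans (expR_ge1Dx _); rewrite lerDl.
  under eq_bigr do rewrite -mulrA.
  by rewrite -mulr_sumr -/(bern_dev _ _) addrC subr_ge0 ler_wpM2l.
rewrite bern_expZ
  (bern_expM P (fun i b => expR (l * c i * ((b : bool)%:R - P i)))) /=.
apply: (@le_trans _ _ (expR (- (l * t)) * \prod_i expR (2 * (l * c i) ^+ 2))).
  rewrite ler_wpM2l ?expR_ge0 //; apply: ler_prod => i _.
  have /andP[P0 P1] := P01 i.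
  by rewrite bern_mgf andbT addr_ge0 // mulr_ge0 ?expR_ge0 ?subr_ge0.
rewrite -expR_sum -expRD ler_expR.
under eq_bigr do rewrite exprMn mulrA.
rewrite -mulr_sumr.
apply: (@le_trans _ _ (- (l * t) + 2 * l ^+ 2 * Q)).
  by rewrite lerD2l ler_wpM2l // mulr_ge0 // sqr_ge0.
rewrite le_eqVlt; apply/orP; left; apply/eqP; rewrite /l.
by field; lra.
Qed.

Lemma hoeffding_abs (c : I -> R) (Q t : R) : 0 < Q -> 0 <= t ->
  \sum_i c i ^+ 2 <= Q ->
  bern_pr P (fun B => t <= `|bern_dev c B|) <= 2 * expR (- (t ^+ 2 / (8 * Q))).
Proof.
move=> Q0 t0 cQ.
have h1 := hoeffding Q0 t0 cQ.
have cQ' : \sum_i (- c i) ^+ 2 <= Q by under eq_bigr do rewrite sqrrN.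
have h2 := hoeffding Q0 t0 cQ'.
rewrite mulrDl mul1r; apply: le_trans (lerD h1 h2).
rewrite -bern_expD; apply: le_bern_exp => B.
have -> : bern_dev (fun i => - c i) B = - bern_dev c B.
  by rewrite /bern_dev -sumrN; apply: eq_bigr => i _; rewrite mulNr.
rewrite ler_normr.
by case: (t <= _); case: (t <= - _); rewrite ?addr0 ?add0r ?lerDl.
Qed.

End Chances.

(** Transfers an event of probability at least one half from [P'] to [P] when
    the chi-square divergence is bounded.  On each subset, the weights [b] for
    [P] and [a] for [P'] satisfy [a <= chi b + a^2 / (4 chi b)], and the last
    terms add up to at most one quarter. *)
Lemma bern_change_of_measure P P' (chi : R) (E : pred {set I}) :
  (forall i, 0 <= P i <= 1) -> (forall i, 0 <= P' i <= 1) ->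
  (forall i, P i = 0 -> P' i = 0) -> (forall i, P i = 1 -> P' i = 1) ->
  0 < chi ->
  \prod_i (P' i ^+ 2 / P i + (1 - P' i) ^+ 2 / (1 - P i)) <= chi ->
  1 / 2 <= bern_pr P' E ->
  1 / (4 * chi) <= bern_pr P E.
Proof.
move=> P01 P'01 ac0 ac1 chi0 hchi half.
pose w := bern_weight P; pose w' := bern_weight P'.
have w0 B : 0 <= w B by apply: bern_weight_ge0.
have w'0 B : 0 <= w' B by apply: bern_weight_ge0.
have ac B : w B = 0 -> w' B = 0.
  move/eqP; rewrite prodf_seq_eq0 => /hasP[i _ /= Hi].
  apply/eqP; rewrite prodf_seq_eq0; apply/hasP; exists i; first by rewrite mem_index_enum.
  move: Hi => /=; case: (i \in B) => /eqP Hi; first by rewrite ac0.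
  by rewrite ac1 ?subrr //; lra.
have chiE : \sum_(B : {set I}) w' B ^+ 2 / w B =
    \prod_i (P' i ^+ 2 / P i + (1 - P' i) ^+ 2 / (1 - P i)).
  rewrite bigA_distr; apply: eq_bigr => B _.
  rewrite /w' /w /bern_weight -prodrXl -prodfV -big_split /=.
  by apply: eq_bigr => i _; case: (i \in B).
have key B : w' B * (E B)%:R <= chi * (w B * (E B)%:R) + w' B ^+ 2 / w B / (4 * chi).
  have [wB|wB] := eqVneq (w B) 0.
    by rewrite wB (ac _ wB) expr0n /= !mul0r mulr0 addr0.
  have wB0 : 0 < w B by rewrite lt_neqAle eq_sym wB w0.
  have -> : w' B ^+ 2 / w B / (4 * chi) = w' B ^+ 2 / (4 * (chi * w B)).
    by field; rewrite ?wB //; lra.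
  have x0 : 0 < chi * w B by rewrite mulr_gt0.
  rewrite mulrA; set x := chi * w B in x0 *.
  case: (E B); rewrite /= ?mulr1 ?mulr0 ?add0r; last first.
    by rewrite divr_ge0 ?sqr_ge0 //; lra.
  rewrite -subr_ge0.
  have -> : x + w' B ^+ 2 / (4 * x) - w' B = (2 * x - w' B) ^+ 2 / (4 * x).
    by field; lra.
  by rewrite divr_ge0 ?sqr_ge0 //; lra.
have sumkey : bern_pr P' E <= chi * bern_pr P E + chi / (4 * chi).
  apply: (@le_trans _ _ (chi * bern_pr P E + (\sum_(B : {set I}) w' B ^+ 2 / w B) / (4 * chi))).
    have : bern_pr P' E <= \sum_(B : {set I})
        (chi * (w B * (E B)%:R) + w' B ^+ 2 / w B / (4 * chi)).
      by apply: ler_sum => B _; exact: key.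
    by rewrite big_split /= -mulr_sumr -mulr_suml.
  by rewrite lerD2l ler_pM2r ?invr_gt0 ?mulr_gt0 // chiE.
have e : chi / (4 * chi) = 1 / 4 by field; lra.
rewrite ler_pdivrMr ?mulr_gt0 //; nra.
Qed.

End Bernoulli.

(** The form in which one-step estimates are proved: a deterministic bound
    that fails on rare events, or improves on a likely one. *)
Lemma bern_exp_le_events (R : realType) (I : finType) (P : I -> R)
    (f : {set I} -> R) (E F : pred {set I}) (a b c : R) :
  (forall i, 0 <= P i <= 1) ->
  (forall B, f B <= a + b * (E B)%:R + c * (F B)%:R) ->
  bern_exp P f <= a + b * bern_pr P E + c * bern_pr P F.
Proof.
move=> P01 fle; apply: le_trans (le_bern_exp P01 fle) _.
by rewrite !bern_expD bern_exp_cst !bern_expZ.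
Qed.

(** * From the sampled neighbors to a one-step operator *)

Lemma opinionsS (V : finType) (A : {set V}) s t :
  opinions A s t.+1 = vote (opinions A s t) (s t).
Proof. by []. Qed.

Lemma eq_opinions (V : finType) (A : {set V}) s1 s2 t :
  (forall i v, (i < t)%N -> s1 i v = s2 i v) -> opinions A s1 t = opinions A s2 t.
Proof.
elim: t => [//|t IH] eqs; rewrite !opinionsS IH; last first.
  by move=> i v it; apply: eqs; apply: ltnW.
by apply/setP => v; rewrite !inE eqs.
Qed.

Lemma vote0 (V : finType) (x : V -> V * V) : vote finset.set0 x = finset.set0.
Proof. by apply/setP => v; rewrite !inE. Qed.

Lemma voteC (V : finType) (A : {set V}) (x : V -> V * V) :
  vote (finset.setC A) x = finset.setC (vote A x).
Proof.
apply/setP => v; rewrite !inE.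
by case: ((x v).1 \in A); case: ((x v).2 \in A).
Qed.

Lemma voteT (V : finType) (x : V -> V * V) : vote finset.setT x = finset.setT.
Proof. by rewrite -finset.setC0 voteC vote0. Qed.

Lemma vote_consensus (V : finType) (A : {set V}) x :
  consensus A -> vote A x = A.
Proof. by case=> ->; rewrite ?vote0 ?voteT. Qed.

(** Consensus is absorbing, so the consensus time is at most [t] if and only if
    there is consensus at time [t]. *)
Lemma consensus_opinions (V : finType) (A : {set V}) s t t' :
  (t <= t')%N -> consensus (opinions A s t) -> consensus (opinions A s t').
Proof.
move=> /subnKC <- c; elim: (t' - t)%N => [|k IH]; first by rewrite addn0.
by rewrite addnS opinionsS vote_consensus.
Qed.

Lemma consensus_time_le (R : realType) (V : finType) (A : {set V}) s (c : R) :
  0 <= c -> (consensus_time R A s <= c%:E)%E =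
  `[< consensus (opinions A s (Num.truncn c)) >].
Proof.
move=> c0; apply/idP/asboolP => [le_c|cons].
  apply: contrapT => ncons.
  have : ((Num.truncn c).+1%:R%:E <= consensus_time R A s)%E.
    apply: le_ereal_inf_tmp => _ [t /= ct <-]; rewrite lee_fin ler_nat ltnNge.
    by apply/negP => tc; apply: ncons; apply: consensus_opinions tc ct.
  move=> /le_trans /(_ le_c); rewrite lee_fin leNgt.
  by have /andP[_ ->] := truncn_itv c0.
apply: (@le_trans _ _ ((Num.truncn c)%:R%:E)).
  by apply: ereal_inf_lbound; exists (Num.truncn c).
by rewrite lee_fin truncn_le.
Qed.

Section Step.
Variables (R : realType) (V : finType) (G : graph V).

Definition samples_pr (x : {ffun V -> V * V}) : R :=
  \prod_v (neighbor_pr R G v (x v).1 * neighbor_pr R G v (x v).2).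

(** The transition operator of the chain of configurations: the expectation of
    [f] after one step started from [A]. *)
Definition step (f : {set V} -> R) (A : {set V}) : R :=
  \sum_x samples_pr x * f (vote A x).

Lemma neighbor_pr_ge0 v w : 0 <= neighbor_pr R G v w.
Proof. by rewrite divr_ge0 ?ler0n. Qed.

Lemma samples_pr_ge0 x : 0 <= samples_pr x.
Proof. by apply: prodr_ge0 => v _; rewrite mulr_ge0 ?neighbor_pr_ge0. Qed.

Lemma le_step f g A : (forall B, f B <= g B) -> step f A <= step g A.
Proof. by move=> fg; apply: ler_sum => x _; rewrite ler_wpM2l ?samples_pr_ge0. Qed.

Lemma stepZ a f A : step (fun B => a * f B) A = a * step f A.
Proof. by rewrite mulr_sumr; apply: eq_bigr => x _; rewrite mulrCA. Qed.

Lemma le_iter_step f g k A :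
  (forall B, f B <= g B) -> iter k step f A <= iter k step g A.
Proof. by move=> fg; elim: k A => //= k IH A; apply: le_step. Qed.

Lemma iter_step_contract (rho : R) (f : {set V} -> R) k A :
  0 <= rho -> (forall B, step f B <= rho * f B) ->
  iter k step f A <= rho ^+ k * f A.
Proof.
move=> rho0 fP; elim: k A => [|k IH] A; first by rewrite expr0 mul1r.
rewrite iterS; apply: (le_trans (le_step _ IH)).
by rewrite stepZ exprSr -mulrA ler_wpM2l // exprn_ge0.
Qed.

Section Samples.
Local Open Scope classical_set_scope.
Variables (d : measure_display) (Omega : measurableType d).
Variables (P : probability Omega R) (S : Omega -> nat -> V -> V * V).
Hypothesis samplesS : best_of_two_samples G P S.

Let history (s : nat -> V -> V * V) j : set Omega :=
  [set w | forall t v, (t < j)%N -> S w t v = s t v].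

Let extend (s : nat -> V -> V * V) j (x : {ffun V -> V * V}) t v :=
  if t == j then x v else s t v.

Let measurable_history s j : measurable (history s j).
Proof.
have -> : history s j =
    \bigcap_(t in `I_j) \bigcap_(v in setT) [set w | S w t v = s t v].
  apply/seteqP; split=> w h.
    by move=> t tj v _; apply: h.
  by move=> t v tj; apply: h.
apply: fin_bigcap_measurable => // t _.
apply: fin_bigcap_measurable => // v _.
by have [+ _] := samplesS; apply.
Qed.

(** The law of [S] is given by its finite-dimensional cylinders only.  Fix the
    samples before time [j] and split the event according to the samples at time
    [j]: this peels off one application of [step], and induction on the number
    [k] of remaining steps yields the law of the configuration. *)
Lemma pr_history_opinions (E : pred {set V}) (A : {set V}) k s j :
  measurable (history s j `&` [set w | E (opinions A (S w) (j + k))]) /\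
  P (history s j `&` [set w | E (opinions A (S w) (j + k))]) =
  ((\prod_(t < j) samples_pr [ffun v => s t v]) *
    iter k step (fun B => (E B)%:R) (opinions A s j))%:E.
Proof.
elim: k s j => [|k IH] s j.
  have -> : history s j `&` [set w | E (opinions A (S w) (j + 0))] =
      if E (opinions A s j) then history s j else set0.
    rewrite addn0; apply/seteqP; split => w /=.
      by move=> [h]; rewrite (eq_opinions A (s2 := s)) // => ->.
    case: ifP => // Es h; split=> //.
    by rewrite (eq_opinions A (s2 := s)).
  split; first by case: ifP.
  case: ifP => Es /=; rewrite Es ?mulr0 ?measure0 //.
  have [_ ->] := samplesS; rewrite mulr1; congr (_%:E).
  by apply: eq_bigr => t _; apply: eq_bigr => v _; rewrite ffunE.
pose F x := history (extend s j x) j.+1 `&` [set w | E (opinions A (S w) (j.+1 + k))].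
have -> : history s j `&` [set w | E (opinions A (S w) (j + k.+1))] =
    \bigcup_(x in [set` index_enum {ffun V -> V * V}]) F x.
  rewrite -addSnnS; apply/seteqP; split=> w /=.
    move=> [h Ew]; exists [ffun v => S w j v]; first exact: mem_index_enum.
    split=> // t v.
    rewrite ltnS leq_eqVlt /extend; case: eqP => [-> _|_ /= tj]; first by rewrite ffunE.
    exact: h.
  move=> [x _ [h Ew]]; split=> // t v tj.
  by rewrite h ?ltnS ?(ltnW tj) // /extend ltn_eqF.
have mF x : measurable (F x) by have [] := IH (extend s j x) j.+1.
split; first by apply: fin_bigcup_measurable.
rewrite measure_fin_bigcup //; last first.
  apply/trivIsetP => x y _ _ xy; apply/seteqP; split=> // w [[hx _] [hy _]].
  move: xy => /eqP[]; apply/ffunP => v.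
  have := hx j v (ltnSn j); rewrite (hy j v (ltnSn j)) /extend eqxx.
  by move=> ->.
rewrite -fsbig_seq ?index_enum_uniq // iterS mulr_sumr -sumEFin.
apply: eq_bigr => x _; have [_ PF] := IH (extend s j x) j.+1; rewrite [LHS]PF.
rewrite big_ord_recr /= mulrA.
have -> : \prod_(t < j) samples_pr [ffun v => extend s j x t v] =
    \prod_(t < j) samples_pr [ffun v => s t v].
  apply: eq_bigr => t _; congr samples_pr; apply/ffunP => v.
  by rewrite !ffunE /extend ltn_eqF.
have -> : [ffun v => extend s j x j v] = x.
  by apply/ffunP => v; rewrite !ffunE /extend eqxx.
have -> : opinions A (extend s j x) j = opinions A s j.
  by apply: eq_opinions => t v tj; rewrite /extend ltn_eqF.
have -> : extend s j x j = x by apply/funext => v; rewrite /extend eqxx.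
by [].
Qed.

Lemma pr_opinions (E : pred {set V}) (A : {set V}) k :
  measurable [set w | E (opinions A (S w) k)] /\
  P [set w | E (opinions A (S w) k)] = (iter k step (fun B => (E B)%:R) A)%:E.
Proof.
have := pr_history_opinions E A k (fun _ v => (v, v)) 0.
rewrite big_ord0 mul1r add0n (_ : history _ 0 = setT) ?setTI //.
exact/seteqP.
Qed.

End Samples.
End Step.

Section OneStep.
Variables (R : realType) (V : finType) (G : graph V).
Implicit Types (A B : {set V}) (v w : V).

Definition sample_in_pr A v : R := \sum_(w in A) neighbor_pr R G v w.

Definition adopt1_pr A v : R :=
  if v \in A then 1 - (1 - sample_in_pr A v) ^+ 2 else sample_in_pr A v ^+ 2.

Lemma sum_neighbor_pr v : \sum_w neighbor_pr R G v w = 1.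
Proof.
transitivity (\sum_(w in sampling_set G v) (#|sampling_set G v|%:R^-1 : R)).
  rewrite [RHS]big_mkcond; apply: eq_bigr => w _.
  by rewrite /neighbor_pr; case: (w \in _); rewrite ?mul1r ?mul0r.
rewrite sumr_const -[LHS]mulr_natl divff // pnatr_eq0 -lt0n; apply/card_gt0P.
rewrite /sampling_set; case: ifPn => [_|/finset.set0Pn //].
by exists v; rewrite inE.
Qed.

Lemma sample_in_prC A v :
  \sum_(w | w \notin A) neighbor_pr R G v w = 1 - sample_in_pr A v.
Proof. by rewrite -(sum_neighbor_pr v) [in RHS](bigID (mem A)) /= addrAC subrr add0r. Qed.

Lemma sample_in_pr01 A v : 0 <= sample_in_pr A v <= 1.
Proof.
rewrite sumr_ge0 ?(fun _ _ => neighbor_pr_ge0) //=; last first.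
  by move=> w _; exact: neighbor_pr_ge0.
rewrite -subr_ge0 -sample_in_prC sumr_ge0 // => w _; exact: neighbor_pr_ge0.
Qed.

Lemma adopt1_pr01 A v : 0 <= adopt1_pr A v <= 1.
Proof.
have := sample_in_pr01 A v; rewrite /adopt1_pr; move: (sample_in_pr A v) => x.
by case: ifP => _ x01; nra.
Qed.

Let adopts1 A v (y : V * V) :=
  if (y.1 \in A) == (y.2 \in A) then y.1 \in A else v \in A.

Lemma sum_adopts1 A v b :
  \sum_(y | adopts1 A v y == b)
     neighbor_pr R G v y.1 * neighbor_pr R G v y.2 =
  if b then adopt1_pr A v else 1 - adopt1_pr A v.
Proof.
have prodE (Q : pred V) :
    \sum_(y | Q y.1 && Q y.2) neighbor_pr R G v y.1 * neighbor_pr R G v y.2 =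
    (\sum_(w | Q w) neighbor_pr R G v w) ^+ 2.
  by rewrite expr2 big_distrlr pair_big.
have sum1 : \sum_(y : V * V) neighbor_pr R G v y.1 * neighbor_pr R G v y.2 = 1.
  have := prodE predT; rewrite sum_neighbor_pr expr1n => <-; exact: eq_bigl.
have compl : \sum_(y | adopts1 A v y == ~~ b)
     neighbor_pr R G v y.1 * neighbor_pr R G v y.2 =
   1 - \sum_(y | adopts1 A v y == b)
     neighbor_pr R G v y.1 * neighbor_pr R G v y.2.
  rewrite -sum1 [in RHS](bigID (fun y => adopts1 A v y == b)) /= addrC addrK.
  by apply: eq_bigl => y; case: (adopts1 _ _ _); case: b.
have inA : \sum_(y | (y.1 \in A) && (y.2 \in A))
     neighbor_pr R G v y.1 * neighbor_pr R G v y.2 = sample_in_pr A v ^+ 2.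
  exact: (prodE (mem A)).
have notinA : \sum_(y | (y.1 \notin A) && (y.2 \notin A))
     neighbor_pr R G v y.1 * neighbor_pr R G v y.2 = (1 - sample_in_pr A v) ^+ 2.
  by rewrite (prodE (fun w => w \notin A)) sample_in_prC.
rewrite /adopt1_pr; have [vA|/negbTE vA] := boolP (v \in A).
- have E : \sum_(y | adopts1 A v y == false)
     neighbor_pr R G v y.1 * neighbor_pr R G v y.2 = (1 - sample_in_pr A v) ^+ 2.
    rewrite -notinA; apply: eq_bigl => y; rewrite /adopts1 vA.
    by case: (_ \in A); case: (_ \in A).
  by move: compl; case: b => /= compl; move: E compl => ->; [move=> ->|]; rewrite ?subKr.
- have E : \sum_(y | adopts1 A v y == true)
     neighbor_pr R G v y.1 * neighbor_pr R G v y.2 = sample_in_pr A v ^+ 2.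
    rewrite -inA; apply: eq_bigl => y; rewrite /adopts1 vA.
    by case: (_ \in A); case: (_ \in A).
  by move: compl; case: b => /= compl; move: E compl => ->; [|move=> ->]; rewrite ?subKr.
Qed.

(** A vertex decides with its own samples only; so the next configuration is a
    product Bernoulli set, to which concentration inequalities apply. *)
Lemma step_bern_exp (f : {set V} -> R) A :
  step G f A = bern_exp (adopt1_pr A) f.
Proof.
rewrite /step (partition_big (fun x : {ffun V -> V * V} => vote A x) predT) //=.
apply: eq_bigr => B _.
transitivity (\sum_(x in family (fun v => [pred y | adopts1 A v y == (v \in B)]))
    samples_pr R G x * f B).
  apply: eq_big => [x|x /eqP -> //].
  apply/eqP/familyP => [<- v|xB]; first by rewrite !inE /adopts1.
  by apply/setP => v; have := xB v; rewrite !inE => /eqP <-.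
rewrite -mulr_suml; congr (_ * _).
rewrite -(bigA_distr_big_dep (fun v y => adopts1 A v y == (v \in B))
   (fun v y => neighbor_pr R G v y.1 * neighbor_pr R G v y.2)).
by apply: eq_bigr => v _; rewrite sum_adopts1.
Qed.

End OneStep.

Lemma stepC (R : realType) (V : finType) (G : graph V) (f : {set V} -> R) A :
  step G f (finset.setC A) = step G (fun B => f (finset.setC B)) A.
Proof. by apply: eq_bigr => x _; rewrite voteC. Qed.

Lemma iter_step_affine (R : realType) (V : finType) (G : graph V) (a : R)
    (f : {set V} -> R) k A :
  iter k (step G) (fun B => 1 + a * f B) A = 1 + a * iter k (step G) f A.
Proof.
elim: k A => [//|k IH] A; rewrite !iterS.
rewrite (_ : iter k (step G) (fun B => 1 + a * f B) =
  (fun B => 1 + a * iter k (step G) f B)); last exact/funext.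
by rewrite !step_bern_exp bern_expD bern_exp_cst bern_expZ.
Qed.

Lemma step_consensus (R : realType) (V : finType) (G : graph V)
    (f : {set V} -> R) A : consensus A -> step G f A = f A.
Proof.
move=> cA; have -> : step G f A = step G (fun=> f A) A.
  by apply: eq_bigr => x _; rewrite vote_consensus.
by rewrite step_bern_exp bern_exp_cst.
Qed.

(** * The mean-field map and its Lyapunov function *)

Section MeanField.
Variables (R : realType) (w : R).
Hypothesis w_ge0 : 0 <= w.

(** Positive exactly when no fixed point off the axis m = 0 is stable. *)
Definition gap : R := 1 - w - w ^+ 2.

Hypothesis gap_gt0 : 0 < gap.

Definition drift_sum (s m : R) : R :=
  s * ((3 - s ^+ 2 - (w ^+ 2 + 2 * w) * m ^+ 2) / 2).

Definition drift_diff (s m : R) : R :=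
  m * (((1 + 2 * w) * (1 - s ^+ 2) - w ^+ 2 * m ^+ 2) / 2).

(** The bound on m^2 must exceed (2 w - 1) / w^2, so that the disparity falls
    below it, and be less than 1 / (w^2 + 2 w), so that small biases grow below
    it (for w > 0).  This value lies between them whenever the gap is positive. *)
Definition trap : R := (1 + w) / (2 + w).

(** Inside the trap, the ratio of s^2 to m^2 grows by a factor that exceeds 1 by
    an amount of order the gap.  The weight [kappa] makes this outweigh the regions
    where s^2 itself shrinks. *)
Definition kappa : R := 12 / gap.

Let w_lt1 : w < 1. Proof. by have := gap_gt0; have := sqr_ge0 w; have := w_ge0; rewrite /gap; lra. Qed.

Let w01 : 0 <= w < 1. Proof. by rewrite w_ge0 w_lt1. Qed.

Lemma gap_le1 : gap <= 1. Proof. have /andP[w0 _] := w01; rewrite /gap; have := sqr_ge0 w; lra. Qed.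

Lemma trapE x : (x <= trap) = ((2 + w) * x <= 1 + w).
Proof. have /andP[w0 w1] := w01; by rewrite /trap ler_pdivlMr 1?mulrC //; lra. Qed.

Lemma trap_ge_half : 1 / 2 <= trap.
Proof. have /andP[w0 w1] := w01; by rewrite trapE; lra. Qed.

Lemma trap_lt1 : trap < 1.
Proof. have /andP[w0 w1] := w01; by rewrite ltr_pdivrMr; lra. Qed.

Lemma kappa_ge12 : 12 <= kappa.
Proof. by rewrite /kappa ler_pdivlMr //; have := gap_le1; lra. Qed.

(** For s = 0 the factor of m is largest, and
    b - b (1 + 2 w - w^2 b^2) / 2 = b (1 - 2 w + w^2 b^2) / 2 is bounded below by
    the gap once b^2 reaches the trap. *)
Lemma drift_diff_le (s m b : R) : `|s| + `|m| <= 1 -> `|m| <= b -> b <= 1 ->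
  trap <= b ^+ 2 -> `|drift_diff s m| <= b - gap / 12.
Proof.
move=> sm mb b1 tb; have /andP[w0 w1] := w01; have g0 := gap_gt0.
have s0 := normr_ge0 s; have m0 := normr_ge0 m.
have b0 : 0 <= b by lra.
rewrite /drift_diff normrM -(real_normK (num_real s)) -(real_normK (num_real m)).
set x := `|s| in s0 sm *; set y := `|m| in m0 sm mb *.
have fac0 : 0 <= (1 + 2 * w) * (1 - x ^+ 2) - w ^+ 2 * y ^+ 2.
  have : 1 - x ^+ 2 >= y ^+ 2 by nra.
  have : w ^+ 2 <= 1 + 2 * w by nra.
  have := sqr_ge0 y; have := sqr_ge0 w; nra.
rewrite ger0_norm ?divr_ge0 //.
have half_b : 1 / 2 <= b by have := trap_ge_half; nra.
have growth : gap / 3 <= 1 - 2 * w + w ^+ 2 * b ^+ 2.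
  have h : (1 + w) <= (2 + w) * b ^+ 2.
    by have : trap * (2 + w) = 1 + w; [rewrite /trap; field; lra|nra].
  have h2 : (2 - w) * gap <= (2 + w) * (1 - 2 * w + w ^+ 2 * b ^+ 2).
    rewrite /gap; have := ler_wpM2l (sqr_ge0 w) h; nra.
  have : 0 < (2 - w) * gap by rewrite mulr_gt0 //; lra.
  have : (2 + w) * gap <= 3 * ((2 - w) * gap) by nra.
  nra.
have e1 : y * (((1 + 2 * w) * (1 - x ^+ 2) - w ^+ 2 * y ^+ 2) / 2) <=
   y * ((1 + 2 * w - w ^+ 2 * y ^+ 2) / 2).
  apply: ler_wpM2l => //; rewrite ler_pM2r ?invr_gt0 //; have := sqr_ge0 x; nra.
have e2 : y * ((1 + 2 * w - w ^+ 2 * y ^+ 2) / 2) <=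
          b * ((1 + 2 * w - w ^+ 2 * b ^+ 2) / 2).
  rewrite -subr_ge0.
  have -> : b * ((1 + 2 * w - w ^+ 2 * b ^+ 2) / 2) -
            y * ((1 + 2 * w - w ^+ 2 * y ^+ 2) / 2) =
    (b - y) * ((1 + 2 * w - w ^+ 2 * (b ^+ 2 + b * y + y ^+ 2)) / 2) by field.
  apply: mulr_ge0; first by lra.
  apply: divr_ge0; last by lra.
  have : b ^+ 2 + b * y + y ^+ 2 <= 3 by nra.
  have : 0 <= b ^+ 2 + b * y + y ^+ 2 by nra.
  have : w ^+ 2 <= w by nra.
  nra.
apply: (le_trans e1); apply: (le_trans e2).
have -> : b * ((1 + 2 * w - w ^+ 2 * b ^+ 2) / 2) =
   b - b * (1 - 2 * w + w ^+ 2 * b ^+ 2) / 2 by field.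
rewrite lerD2l lerN2; nra.
Qed.

(** With lambda_s and lambda_m the factors of s and m, the claim is
    (1 - lambda_s^2) - kappa m^2 (lambda_s^2 - lambda_m^2) <= - (1 - s^2) - m^2.
    Here 1 - lambda_s^2 <= 2 (1 - lambda_s) = s^2 + (w^2 + 2 w) m^2 - 1, and in
    the trap lambda_s - lambda_m is at least two thirds of the gap, so that the
    second term absorbs (w^2 + 2 w + 1) m^2. *)
Lemma lyapunov_decrease (s m : R) : `|s| + `|m| <= 1 -> m ^+ 2 <= trap ->
  let ls := (3 - s ^+ 2 - (w ^+ 2 + 2 * w) * m ^+ 2) / 2 in
  1 / 2 <= ls <= 3 / 2 /\
  1 + kappa * drift_diff s m ^+ 2 <=
    ls ^+ 2 * (1 + kappa * m ^+ 2) - (1 - s ^+ 2) - m ^+ 2.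
Proof.
move=> sm; rewrite trapE => mt ls; have /andP[w0 w1] := w01.
have s0 := normr_ge0 s; have m0 := normr_ge0 m.
pose lm : R := ((1 + 2 * w) * (1 - s ^+ 2) - w ^+ 2 * m ^+ 2) / 2.
have lsE : ls * 2 = 3 - s ^+ 2 - (w ^+ 2 + 2 * w) * m ^+ 2 by rewrite /ls; field.
have lmE : lm * 2 = (1 + 2 * w) * (1 - s ^+ 2) - w ^+ 2 * m ^+ 2 by rewrite /lm; field.
have -> : drift_diff s m = m * lm by [].
have S1 : s ^+ 2 <= 1 by rewrite -(real_normK (num_real s)); nra.
have SM : m ^+ 2 <= 1 - s ^+ 2.
  by rewrite -(real_normK (num_real s)) -(real_normK (num_real m)); nra.
have S0 := sqr_ge0 s; have M0 := sqr_ge0 m; have W0 := sqr_ge0 w.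
have g0 := gap_gt0.
have g1 : w + w ^+ 2 < 1 by have := g0; rewrite /gap; lra.
set S := s ^+ 2 in lsE lmE S0 S1 SM *; set M := m ^+ 2 in lsE lmE SM M0 mt *.
have aM : (w ^+ 2 + 2 * w) * M <= 1.
  have : w * ((2 + w) * M) <= w * (1 + w) by apply: ler_wpM2l.
  nra.
have aM0 : 0 <= (w ^+ 2 + 2 * w) * M by apply: mulr_ge0 => //; lra.
have lm0 : 0 <= lm.
  have : w ^+ 2 * M <= (1 + 2 * w) * M by apply: ler_wpM2r => //; nra.
  nra.
have ls_half : 1 / 2 <= ls by lra.
have ls_le : ls <= 3 / 2 by lra.
have kg : kappa * gap = 12 by rewrite /kappa mulfVK // gt_eqF.
have diff : 2 * gap / 3 <= ls - lm.
  have e : ls - lm = 1 - w + w * S - w * M by lra.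
  rewrite e /gap; have : w * ((2 + w) * M) <= w * (1 + w) by apply: ler_wpM2l.
  have : 0 <= w * S by apply: mulr_ge0.
  have wM0 : 0 <= w * M by apply: mulr_ge0.
  nra.
have k0 : 0 < kappa by have := kappa_ge12; lra.
have sqdiff : gap / 3 <= ls ^+ 2 - lm ^+ 2.
  have -> : ls ^+ 2 - lm ^+ 2 = (ls - lm) * (ls + lm) by ring.
  nra.
have main : 4 * M <= kappa * M * (ls ^+ 2 - lm ^+ 2).
  have := ler_wpM2l (mulr_ge0 (ltW k0) M0) sqdiff.
  have -> : kappa * M * (gap / 3) = (kappa * gap) * M / 3 by ring.
  rewrite kg; lra.
have lsq : 1 - ls ^+ 2 <= 2 * (1 - ls) by have := sqr_ge0 (1 - ls); nra.
have a3 : (w ^+ 2 + 2 * w) * M <= 3 * M by apply: ler_wpM2r => //; nra.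
split; first by apply/andP.
rewrite exprMn -/M; nra.
Qed.

Lemma trap_stable (s m e m' : R) : `|s| + `|m| <= 1 -> m ^+ 2 <= trap ->
  `|m'| <= `|drift_diff s m| + e -> e <= gap / 12 -> m' ^+ 2 <= trap.
Proof.
move=> sm mt m'e eg; have t0 := trap_ge_half; have t1 := trap_lt1.
pose b := Num.sqrt trap.
have bb : b ^+ 2 = trap by rewrite sqr_sqrtr //; lra.
have b0 : 0 <= b by apply: sqrtr_ge0.
have b1 : b <= 1 by rewrite -(@ler_pXn2r _ 2) ?nnegrE // bb expr1n; lra.
have mb : `|m| <= b by rewrite -(@ler_pXn2r _ 2) ?nnegrE // bb real_normK ?num_real.
have tb : trap <= b ^+ 2 by rewrite bb.
have h := drift_diff_le sm mb b1 tb.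
rewrite -(real_normK (num_real m')) -bb ler_pXn2r ?nnegrE //; lra.
Qed.

(** The cut-off is tested by cross-multiplication, which gives the right value
    at s = 0 as well. *)
Definition lyap (cap s m : R) : R :=
  if m ^+ 2 <= trap then
    if s ^+ 2 * (cap + 1) <= 1 + kappa * m ^+ 2 then cap
    else (1 + kappa * m ^+ 2) / s ^+ 2 - 1
  else cap * (1 + `|m|).

Let num_gt0 m : 0 < 1 + kappa * m ^+ 2.
Proof.
have := sqr_ge0 m; have k0 := kappa_ge12 => m0.
have : 0 <= kappa * m ^+ 2 by apply: mulr_ge0 => //; lra.
lra.
Qed.

Lemma lyapN cap s m : lyap cap (- s) (- m) = lyap cap s m.
Proof. by rewrite /lyap !sqrrN normrN. Qed.

Lemma lyap_le_cap cap s m : 0 <= cap -> m ^+ 2 <= trap -> lyap cap s m <= cap.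
Proof.
move=> cap0 mt; rewrite /lyap mt; case: (leP (_ * _)) => // lt.
have S0 : 0 < s ^+ 2 by have := num_gt0 m; have := sqr_ge0 s; nra.
by rewrite lerBlDr ler_pdivrMr // [leRHS]mulrC ltW.
Qed.

Lemma lyap_le_ratio cap s m : m ^+ 2 <= trap -> s != 0 ->
  lyap cap s m <= (1 + kappa * m ^+ 2) / s ^+ 2 - 1.
Proof.
move=> mt s0; rewrite /lyap mt; case: (leP (_ * _)) => // le.
by rewrite lerBrDr ler_pdivlMr ?exprn_even_gt0 // [leLHS]mulrC.
Qed.

Lemma lyap_le2 cap s m : 0 <= cap -> `|m| <= 1 -> lyap cap s m <= 2 * cap.
Proof.
move=> cap0 m1; have [mt|mt] := leP (m ^+ 2) trap.
  by have := lyap_le_cap s cap0 mt; lra.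
by rewrite /lyap ifN -?ltNge //; nra.
Qed.

Lemma lyap_ge cap s m : 0 <= cap -> `|s| <= 1 ->
  Num.min cap (1 - s ^+ 2) <= lyap cap s m.
Proof.
move=> cap0 s1; rewrite /lyap ge_min.
case: ifP => mt; last by rewrite ler_peMr //; have := normr_ge0 m; lra.
case: (leP (_ * _)) => [|lt]; first by rewrite lexx.
apply/orP; right.
have S0 : 0 < s ^+ 2 by have := num_gt0 m; have := sqr_ge0 s; nra.
have S1 : s ^+ 2 <= 1 by rewrite -(real_normK (num_real s)) expr_le1.
rewrite lerBrDr ler_pdivlMr //.
have : 0 <= kappa * m ^+ 2 by rewrite mulr_ge0 ?sqr_ge0 //; have := kappa_ge12; lra.
nra.
Qed.

Definition rate (e : R) : R := 2 * e / (9 * (1 + kappa)).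

(* Keeps only the data of the section: the facts that an inequality follows
   from are moved into the goal first. *)
Ltac arith_context := clear -R w w_ge0 gap_gt0 w_lt1 w01 num_gt0.

(** A robust form of [lyapunov_decrease]: away from consensus, the decrease
    survives a small relative error on s' and a small absolute error on m'. *)
Lemma ratio_contract (eps e s m s' m' : R) : 0 < eps -> eps <= 1 ->
  `|s| + `|m| <= 1 -> m ^+ 2 <= trap -> `|s| <= 1 - eps -> s != 0 ->
  (1 - rate eps / 4) * `|drift_sum s m| <= `|s'| ->
  `|m'| <= `|drift_diff s m| + e -> 0 <= e <= 1 -> 3 * kappa * e <= eps / 2 ->
  (1 + kappa * m' ^+ 2) / s' ^+ 2 - 1 <=
  (1 - rate eps / 2) * ((1 + kappa * m ^+ 2) / s ^+ 2 - 1).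
Proof.
move=> eps0 eps1 sm mt s_eps s_neq0 s'_ge m'_le /andP[e0 e1] ke.
have k12 := kappa_ge12.
have s0 := normr_ge0 s; have m0 := normr_ge0 m.
have M0 := sqr_ge0 m.
have M1 : m ^+ 2 <= 1 by rewrite -(real_normK (num_real m)); nra.
have S0 : 0 < s ^+ 2 by rewrite exprn_even_gt0.
have [/=] := lyapunov_decrease sm mt.
set ls := ((3 - _ - _) / 2) => /andP[ls0 ls1] key.
have d1 : `|drift_diff s m| <= 1.
  have m1 : `|m| <= 1 by lra.
  have t1 : trap <= 1 ^+ 2 by rewrite expr1n ltW ?trap_lt1.
  by have := drift_diff_le sm m1 (lexx 1) t1; have := gap_gt0; lra.
have m'2 : m' ^+ 2 <= drift_diff s m ^+ 2 + 3 * e.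
  rewrite -(real_normK (num_real m')) -(real_normK (num_real (drift_diff s m))).
  have := normr_ge0 (drift_diff s m); have := normr_ge0 m'.
  by move: m'_le e0 e1 d1; arith_context; nra.
have eps_le : eps <= 1 - s ^+ 2.
  rewrite -(real_normK (num_real s)).
  by move: s0 s_eps eps0 eps1; arith_context; nra.
set N := 1 + kappa * m ^+ 2 in key *; set N' := 1 + kappa * m' ^+ 2.
have N'_le : N' <= ls ^+ 2 * N - eps / 2.
  have : kappa * m' ^+ 2 <= kappa * (drift_diff s m ^+ 2 + 3 * e).
    by apply: ler_wpM2l => //; move: k12; arith_context; lra.
  by rewrite /N'; move: key eps_le M0 ke; arith_context; lra.
have N0 : 0 < N by rewrite /N num_gt0.
have N_le : N <= 1 + kappa by rewrite /N; move: M1 k12; arith_context; nra.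
have ls2 : 1 / 4 <= ls ^+ 2 <= 9 / 4 by apply/andP; split; move: ls0 ls1; arith_context; nra.
set z := rate eps.
have zE : z * (9 * (1 + kappa)) = 2 * eps by rewrite /z /rate mulfVK //; move: k12; arith_context; lra.
have z0 : 0 < z by rewrite /z /rate divr_gt0 //; move: eps0 k12; arith_context; lra.
have z1 : z <= 1 by move: zE eps1 k12 z0; arith_context; nra.
move/andP: ls2 => [ls2_ge ls2_le].
have zlsN : z * (ls ^+ 2 * N) <= eps / 2.
  have : ls ^+ 2 * N <= 9 / 4 * (1 + kappa) by apply: ler_pM => //; move: ls2_ge N0; arith_context; lra.
  by move/(ler_wpM2l (ltW z0)); move: zE; arith_context; lra.
have N'_le2 : N' <= (1 - z / 2) * (1 - z / 4) ^+ 2 * (ls ^+ 2 * N).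
  have : (1 - z) <= (1 - z / 2) * (1 - z / 4) ^+ 2.
    have : 1 - z / 2 <= (1 - z / 4) ^+ 2 by arith_context; nra.
    by move: z0 z1; arith_context; nra.
  have : 0 < ls ^+ 2 * N by rewrite mulr_gt0 //; move: ls2_ge; arith_context; lra.
  by move: N'_le zlsN; arith_context; nra.
have S'_ge : (1 - z / 4) ^+ 2 * (ls ^+ 2 * s ^+ 2) <= s' ^+ 2.
  have -> : (1 - z / 4) ^+ 2 * (ls ^+ 2 * s ^+ 2) =
      ((1 - z / 4) * `|drift_sum s m|) ^+ 2.
    by rewrite [RHS]exprMn (real_normK (num_real _)) /drift_sum -/ls; ring.
  rewrite -(real_normK (num_real s')) ler_pXn2r ?nnegrE //.
  by rewrite mulr_ge0 //; move: z1; arith_context; lra.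
have S'0 : 0 < s' ^+ 2.
  apply: lt_le_trans S'_ge; apply: mulr_gt0; first by apply: exprn_gt0; move: z1; arith_context; lra.
  by apply: mulr_gt0 => //; move: ls2_ge; arith_context; lra.
have N'_ratio : N' / s' ^+ 2 <= (1 - z / 2) * (N / s ^+ 2).
  rewrite ler_pdivrMr //; apply: (le_trans N'_le2).
  have -> : (1 - z / 2) * (1 - z / 4) ^+ 2 * (ls ^+ 2 * N) =
    (1 - z / 2) * (N / s ^+ 2) * ((1 - z / 4) ^+ 2 * (ls ^+ 2 * s ^+ 2)).
    by field.
  apply: ler_wpM2l => //; rewrite mulr_ge0 ?divr_ge0 ?ltW //; move: z0 z1; arith_context; lra.
move: N'_ratio z0; arith_context; lra.
Qed.

End MeanField.

(** * Block statistics and their drift on a good graph *)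

Section Blocks.
Variables (R : realType) (n : nat).
Implicit Types (A B : {set vertex n}) (v : vertex n) (f : vertex n -> R).

Lemma sum_vertex f : \sum_v f v = \sum_i f (true, i) + \sum_i f (false, i).
Proof.
rewrite (eq_bigr (fun v => f (v.1, v.2))) => [|[]//].
rewrite -(pair_bigA _ (fun b i => f (b, i))) /=.
by rewrite big_bool.
Qed.

Definition block_sign v : R := if v.1 then 1 else -1.

Definition mean_sum f : R := (\sum_v f v) / n%:R - 1.
Definition mean_diff f : R := (\sum_v block_sign v * f v) / n%:R.

Definition opinion A v : R := (v \in A)%:R.
Definition bias A := mean_sum (opinion A).
Definition disparity A := mean_diff (opinion A).

Hypothesis n_gt0 : (0 < n)%N.

Let nR0 : 0 < n%:R :> R. Proof. by rewrite ltr0n. Qed.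

Let nRneq0 : n%:R != 0 :> R. Proof. by rewrite gt_eqF. Qed.

Let count b A : R := \sum_(i < n) opinion A (b, i).

Let count_bounds b A : 0 <= count b A <= n%:R.
Proof.
apply/andP; split; first by apply: sumr_ge0 => i _; rewrite ler0n.
apply: (@le_trans _ _ (\sum_(i < n) 1)).
  by apply: ler_sum => i _; rewrite /opinion; case: (_ \in _).
by rewrite sumr_const card_ord.
Qed.

Let biasE A : bias A * n%:R = count true A + count false A - n%:R.
Proof. by rewrite /bias /mean_sum sum_vertex mulrBl mulfVK // mul1r. Qed.

Let disparityE A : disparity A * n%:R = count true A - count false A.
Proof.
rewrite /disparity /mean_diff mulfVK // sum_vertex /block_sign /=.
by congr (_ + _); rewrite -?sumrN; apply: eq_bigr => i _; rewrite ?mul1r ?mulN1r.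
Qed.

Lemma bias_disparity_le1 A : `|bias A| + `|disparity A| <= 1.
Proof.
have /andP[c1 c1'] := count_bounds true A.
have /andP[c2 c2'] := count_bounds false A.
have bE := biasE A; have dE := disparityE A; have n0 := nR0.
have h1 : `|bias A + disparity A| <= 1.
  by rewrite -(@ler_pM2r _ n%:R) // -[X in _ * X]gtr0_norm // -normrM ler_norml; nra.
have h2 : `|bias A - disparity A| <= 1.
  by rewrite -(@ler_pM2r _ n%:R) // -[X in _ * X]gtr0_norm // -normrM ler_norml; nra.
by move: h1 h2; rewrite !ler_norml; case: (ler0P (bias A)); case: (ler0P (disparity A)); lra.
Qed.

Lemma bias_card A : bias A = #|A|%:R / n%:R - 1.
Proof.
rewrite /bias /mean_sum; congr (_ / _ - 1).
rewrite -sum1_card natr_sum [RHS]big_mkcond; apply: eq_bigr => v _.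
by rewrite /opinion; case: (v \in A).
Qed.

Let opinionC A v : opinion (finset.setC A) v = 1 - opinion A v.
Proof. by rewrite /opinion finset.in_setC; case: (v \in A); rewrite ?subr0 ?subrr. Qed.

Lemma biasC A : bias (finset.setC A) = - bias A.
Proof.
rewrite /bias /mean_sum (eq_bigr _ (fun v _ => opinionC A v)) sumrB sumr_const.
rewrite card_prod card_bool card_ord natrM.
by have n0 := nR0; field; rewrite gt_eqF.
Qed.

Lemma disparityC A : disparity (finset.setC A) = - disparity A.
Proof.
rewrite /disparity /mean_diff -mulNr; congr (_ / _).
rewrite (eq_bigr (fun v => block_sign v - block_sign v * opinion A v)); last first.
  by move=> v _; rewrite opinionC; ring.
rewrite sumrB sum_vertex /block_sign /= !sumr_const card_ord mulNrn subrr.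
by rewrite sub0r.
Qed.

Variables (w : R).

Definition field A v : R := (1 + bias A + block_sign v * w * disparity A) / 2.

Definition adopt1 (a : bool) (x : R) : R :=
  if a then 1 - (1 - x) ^+ 2 else x ^+ 2.

Let sum_adopt1 A b :
  let x := (1 + bias A + (if b then 1 else -1) * w * disparity A) / 2 in
  \sum_(i < n) adopt1 ((b, i) \in A) (field A (b, i)) =
  n%:R * x ^+ 2 + count b A * (2 * x * (1 - x)).
Proof.
move=> x; transitivity (\sum_(i < n) adopt1 ((b, i) \in A) x); first by [].
rewrite /count mulr_suml mulr_natl -[in X in X + _](card_ord n) -sumr_const -big_split /=.
by apply: eq_bigr => i _; rewrite /opinion /adopt1; case: (_ \in _) => /=; ring.
Qed.

(** Within a block, all vertices see the same field, and the sum depends on A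
    only through the number of its members there. *)
Lemma mean_sum_adopt1 A :
  mean_sum (fun v => adopt1 (v \in A) (field A v)) =
  drift_sum w (bias A) (disparity A).
Proof.
rewrite /mean_sum sum_vertex (sum_adopt1 A true) (sum_adopt1 A false) /drift_sum.
have bE := biasE A; have dE := disparityE A.
have -> : count true A = n%:R * (1 + bias A + disparity A) / 2 by lra.
have -> : count false A = n%:R * (1 + bias A - disparity A) / 2 by lra.
by field.
Qed.

Lemma mean_diff_adopt1 A :
  mean_diff (fun v => adopt1 (v \in A) (field A v)) =
  drift_diff w (bias A) (disparity A).
Proof.
rewrite /mean_diff sum_vertex -!mulr_sumr.
rewrite (sum_adopt1 A true) (sum_adopt1 A false) /drift_diff /block_sign /=.
have bE := biasE A; have dE := disparityE A.
have -> : count true A = n%:R * (1 + bias A + disparity A) / 2 by lra.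
have -> : count false A = n%:R * (1 + bias A - disparity A) / 2 by lra.
by field.
Qed.

Lemma adopt1_lipschitz a x y : 0 <= x <= 1 -> 0 <= y <= 1 ->
  `|adopt1 a x - adopt1 a y| <= 2 * `|x - y|.
Proof.
move=> /andP[x0 x1] /andP[y0 y1]; rewrite /adopt1; case: a.
  have -> : 1 - (1 - x) ^+ 2 - (1 - (1 - y) ^+ 2) = (2 - x - y) * (x - y) by ring.
  by rewrite normrM ler_wpM2r // ger0_norm; lra.
have -> : x ^+ 2 - y ^+ 2 = (x + y) * (x - y) by ring.
by rewrite normrM ler_wpM2r // ger0_norm; lra.
Qed.

Hypothesis w01 : 0 <= w <= 1.

Lemma field01 A v : 0 <= field A v <= 1.
Proof.
have /andP[w0 w1] := w01.
have sm := bias_disparity_le1 A.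
have h : `|block_sign v * w * disparity A| <= `|disparity A|.
  rewrite !normrM [`|w|]ger0_norm //.
  have -> : `|block_sign v| = 1 by rewrite /block_sign; case: ifP; rewrite ?normrN normr1.
  by rewrite mul1r ler_piMl.
have h2 : `|bias A + block_sign v * w * disparity A| <= 1.
  by apply: le_trans (ler_normD _ _) _; lra.
by move: h2; rewrite ler_norml /field; lra.
Qed.

End Blocks.

Section GoodGraph.
Variables (R : realType) (n : nat) (p q : R).
Hypothesis n_gt0 : (0 < n)%N.
Hypotheses (q_gt0 : 0 < q) (q_le_p : q <= p) (p_le1 : p <= 1).
Implicit Types (A : {set vertex n}) (v : vertex n) (G : graph (vertex n)).

Definition link_pr (v u : vertex n) : R := if v.1 == u.1 then p else q.

Definition expected_degree_in A v : R := \sum_(u in A) link_pr v u.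

Definition degree_in G A v : R := #|neighbors G v :&: A|%:R.

(** The first clause holds for all sets A at once; it bounds the sum of the
    errors, not each of them, since some A may contain the whole neighborhood of a
    given vertex. *)
Definition good_graph G : Prop :=
  (forall A, \sum_v `|degree_in G A v - expected_degree_in A v| <=
     26 * n%:R * Num.sqrt n%:R) /\
  (forall v, q * n%:R / 2 <= degree_in G finset.setT v).

Definition contrast : R := (p - q) / (p + q).

Let nR0 : 0 < n%:R :> R. Proof. by rewrite ltr0n. Qed.

Lemma contrast01 : 0 <= contrast <= 1.
Proof.
have q0 := q_gt0; have qp := q_le_p; rewrite /contrast.
by rewrite divr_ge0 /= ?ler_pdivrMr; lra.
Qed.

Lemma expected_degree_in_field A v :
  expected_degree_in A v = n%:R * (p + q) * field contrast A v.
Proof.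
have q0 := q_gt0; have qp := q_le_p; have n0 := nR0.
rewrite /expected_degree_in.
transitivity (\sum_u link_pr v u * opinion R A u).
  rewrite big_mkcond; apply: eq_bigr => u _.
  by rewrite /opinion; case: (u \in A); rewrite ?mulr1 ?mulr0.
rewrite /field /bias /disparity /mean_sum /mean_diff !sum_vertex /link_pr /block_sign /=.
rewrite -!mulr_sumr /contrast.
have pq0 : 0 < p + q by lra.
case: v.1 => /=; field; by rewrite (gt_eqF n0) (gt_eqF pq0) /=.
Qed.

Variable G : graph (vertex n).
Hypothesis goodG : good_graph G.

Lemma degree_gt0 v : 0 < degree_in G finset.setT v.
Proof.
have [_ /(_ v)] := goodG; apply: lt_le_trans.
by rewrite divr_gt0 // mulr_gt0.
Qed.

Lemma sample_in_prE A v :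
  sample_in_pr R G A v = degree_in G A v / degree_in G finset.setT v.
Proof.
have := degree_gt0 v; rewrite /degree_in finset.setIT /sample_in_pr /neighbor_pr.
rewrite ltr0n lt0n cards_eq0 /sampling_set => /negbTE ->.
rewrite -mulr_suml; congr (_ / _).
rewrite -sum1_card natr_sum [LHS]big_mkcond [RHS]big_mkcond; apply: eq_bigr => u _.
by rewrite finset.in_setI; case: (_ \in neighbors G v); case: (_ \in A).
Qed.

Lemma degree_in_le A v : degree_in G A v <= degree_in G finset.setT v.
Proof. by rewrite ler_nat finset.setIT subset_leq_card ?finset.subsetIl. Qed.

(** Taking the whole vertex set for A in the first clause of [good_graph] shows
    that degrees, too, are close to their common expectation on average. *)
Lemma sum_sample_in_pr_field A :
  \sum_v `|sample_in_pr R G A v - field contrast A v| <=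
  52 * Num.sqrt n%:R / (p + q).
Proof.
have q0 := q_gt0; have qp := q_le_p; have n0 := nR0.
have [disc _] := goodG.
pose D : R := n%:R * (p + q).
have D0 : 0 < D by rewrite mulr_gt0 //; lra.
have fieldT v : field contrast (finset.setT : {set vertex n}) v = 1.
  have : expected_degree_in finset.setT v = D.
    rewrite /expected_degree_in (eq_bigl predT) => [|u]; last by rewrite inE.
    rewrite sum_vertex /link_pr /= !sumr_const card_ord.
    rewrite -[X in X + _]mulr_natl -[X in _ + X]mulr_natl /D.
    by case: v.1 => /=; ring.
  rewrite expected_degree_in_field -/D => /(congr1 (fun x => D^-1 * x)).
  by rewrite mulKf ?mulVf ?gt_eqF.
have pt v : `|sample_in_pr R G A v - field contrast A v| <=
   (`|degree_in G A v - expected_degree_in A v| +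
    `|degree_in G finset.setT v - expected_degree_in finset.setT v|) / D.
  have d0 := degree_gt0 v; have da := degree_in_le A v.
  rewrite sample_in_prE !expected_degree_in_field fieldT mulr1 -/D.
  set d := degree_in G finset.setT v in d0 da *.
  set a := degree_in G A v in da *; set x := field _ _ _.
  have a0 : 0 <= a by apply: ler0n.
  have -> : a / d - x = (a - D * x) / D + (a / d) * ((D - d) / D).
    by field; rewrite !gt_eqF.
  apply: le_trans (ler_normD _ _) _; rewrite [leRHS]mulrDl.
  rewrite !normrM [ `|D^-1| ]gtr0_norm ?invr_gt0 //.
  rewrite lerD2l [ `|D - d| ]distrC ler_piMl ?mulr_ge0 ?invr_ge0 ?(ltW D0) //.
  by rewrite -normrM ger0_norm ?divr_ge0 ?(ltW d0) // ler_pdivrMr // mul1r.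
apply: (le_trans (ler_sum _ (fun v _ => pt v))).
rewrite -mulr_suml big_split /=.
have h := lerD (disc A) (disc finset.setT).
rewrite ler_pdivrMr //; apply: (le_trans h).
rewrite le_eqVlt; apply/orP; left; apply/eqP; rewrite /D; field; lra.
Qed.

Definition drift_error : R := 104 / (p + q).

Let adopt1_error A :
  \sum_v `|adopt1_pr R G A v - adopt1 (v \in A) (field contrast A v)| <=
  drift_error * Num.sqrt n%:R.
Proof.
have q0 := q_gt0; have qp := q_le_p; have n0 := nR0.
have -> : drift_error * Num.sqrt n%:R = 2 * (52 * Num.sqrt n%:R / (p + q)).
  by rewrite /drift_error; field; lra.
apply: le_trans (ler_wpM2l _ (sum_sample_in_pr_field A)) => //.
rewrite mulr_sumr; apply: ler_sum => v _.
apply: adopt1_lipschitz; first exact: sample_in_pr01.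
by apply: field01; rewrite ?contrast01.
Qed.

Let inv_sqrt : Num.sqrt n%:R / n%:R = (Num.sqrt n%:R)^-1 :> R.
Proof.
have n0 := nR0.
rewrite -[X in _ / X](sqr_sqrtr (ler0n R n)) expr2 invfM mulrA divff ?mul1r //.
by rewrite gt_eqF ?sqrtr_gt0.
Qed.

(** A step deviates from the mean-field map by O(n^(-1/2)) in expectation; the
    deviation may have any sign. *)
Lemma mean_sum_drift A :
  `|mean_sum (adopt1_pr R G A) - drift_sum contrast (bias R A) (disparity R A)| <=
  drift_error / Num.sqrt n%:R.
Proof.
have n0 := nR0.
rewrite -mean_sum_adopt1 // /mean_sum opprB addrA subrK -mulrBl -sumrB.
rewrite normrM normfV [ `|n%:R| ]gtr0_norm // -inv_sqrt mulrA ler_pM2r ?invr_gt0 //.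
exact: le_trans (ler_norm_sum _ _ _) (adopt1_error A).
Qed.

Lemma mean_diff_drift A :
  `|mean_diff (adopt1_pr R G A) - drift_diff contrast (bias R A) (disparity R A)| <=
  drift_error / Num.sqrt n%:R.
Proof.
have n0 := nR0.
rewrite -mean_diff_adopt1 // /mean_diff -mulrBl -sumrB.
rewrite normrM normfV [ `|n%:R| ]gtr0_norm // -inv_sqrt mulrA ler_pM2r ?invr_gt0 //.
apply: le_trans (ler_norm_sum _ _ _) (le_trans _ (adopt1_error A)).
apply: ler_sum => v _; rewrite -mulrBr normrM.
by rewrite /block_sign; case: ifP; rewrite ?normrN normr1 mul1r.
Qed.

End GoodGraph.

(** * A random graph is good *)

Section RandomGraph.
Variables (R : realType) (n : nat) (p q : R).
Hypothesis n_gt0 : (0 < n)%N.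
Hypotheses (q_gt0 : 0 < q) (q_le_p : q <= p) (p_le1 : p <= 1).
Implicit Types (A B : {set vertex n}) (u v : vertex n) (G : graph (vertex n)).
Implicit Types (e : {set vertex n}).

Let nR0 : 0 < n%:R :> R. Proof. by rewrite ltr0n. Qed.

(** With zero chances outside the two-element sets, the random graph is a
    product Bernoulli set of edges. *)
Definition pair_pr e : R :=
  if e \in vertex_pairs (vertex n) then edge_pr p q e else 0.

Lemma pair_pr01 e : 0 <= pair_pr e <= 1.
Proof.
have q0 := q_gt0; have qp := q_le_p; have p1 := p_le1.
by rewrite /pair_pr /edge_pr; case: ifP => _; [case: ifP => _|]; lra.
Qed.

Lemma sbm_prE (Q : graph (vertex n) -> Prop) :
  sbm_pr p q Q = bern_exp pair_pr (fun G => `[< Q G >]%:R).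
Proof.
rewrite /sbm_pr big_mkcond; apply: eq_bigr => G _.
have -> : bern_weight pair_pr G =
    if G \subset vertex_pairs (vertex n) then sbm_weight p q G else 0.
  case: ifPn => [Gpairs|/subsetPn[e eG eN]].
    rewrite /bern_weight /sbm_weight [RHS]big_mkcond; apply: eq_bigr => e _.
    rewrite /pair_pr; have [//|eN] := boolP (e \in vertex_pairs _).
    have [eG|_] := boolP (e \in G); last by rewrite subr0.
    by rewrite (fintype.subsetP Gpairs _ eG) in eN.
  by rewrite /bern_weight (bigD1 e) //= eG /pair_pr (negbTE eN) mul0r.
by case: (_ \subset _); case: `[< _ >]; rewrite ?mulr1 ?mulr0 ?mul0r.
Qed.

Lemma pair_pr_link u v : u != v -> pair_pr [set u; v]%SET = link_pr p q u v.
Proof.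
move=> uv; rewrite /pair_pr inE cards2 uv /edge_pr /link_pr; congr (if _ then _ else _).
apply/forall_inP/eqP => [h|uv1 x].
  have /forall_inP/(_ v) := h u (set21 _ _); rewrite set22 => /(_ isT)/eqP //.
rewrite !inE => /orP[]/eqP ->; apply/forall_inP => y; rewrite !inE => /orP[]/eqP ->;
  by rewrite ?uv1.
Qed.

Variable coef : vertex n -> vertex n -> R.

(** A linear statistic of the edges, indexed by ordered pairs.  Both clauses of
    [good_graph] bound statistics of this kind. *)
Definition link_dev G : R :=
  \sum_v \sum_(u | u != v) coef v u * (([set v; u]%SET \in G)%:R - link_pr p q v u).

Let edge_coef e : R :=
  \sum_v \sum_(u | u != v) coef v u * ([set v; u]%SET == e)%:R.

Let link_devE G : link_dev G = bern_dev pair_pr edge_coef G.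
Proof.
rewrite /bern_dev; under [RHS]eq_bigr do rewrite mulr_suml.
rewrite exchange_big; apply: eq_bigr => v _ /=.
under [RHS]eq_bigr do rewrite mulr_suml.
rewrite exchange_big; apply: eq_bigr => u uv /=.
rewrite (bigD1 [set v; u]%SET) //= eqxx mulr1 big1 ?addr0; last first.
  by move=> e /negbTE; rewrite eq_sym => ->; rewrite mulr0 mul0r.
by rewrite pair_pr_link // eq_sym.
Qed.

Let two_ends e : \sum_v \sum_(u | u != v) ([set v; u]%SET == e)%:R <= 2 :> R.
Proof.
have h v : \sum_(u | u != v) ([set v; u]%SET == e)%:R <=
    ((v \in e) && (#|e| == 2))%:R :> R.
  case: (boolP (_ && _)) => [/andP[ve /eqP e2]|N]; last first.
    rewrite big1 // => u uv; case: eqP => // eE; move: N.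
    by rewrite -eE !inE eqxx cards2 eq_sym uv.
  have sum1 : \sum_u (u \in e :\ v)%:R = 1 :> R.
    rewrite -natr_sum -big_mkcond sum1_card.
    by have := cardsD1 v e; rewrite ve e2 add1n => -[] /esym ->.
  apply: (@le_trans _ _ (\sum_u (u \in e :\ v)%:R)); last by rewrite sum1.
  rewrite big_mkcond; apply: ler_sum => u _; case: ifP => uv; last by rewrite ler0n.
  by case: eqP => [<-|_]; rewrite ?ler0n // !inE eqxx uv orbT.
apply: (le_trans (ler_sum _ (fun v _ => h v))).
rewrite -natr_sum; case: eqP => [e2|_]; last by rewrite big1 // => v _; rewrite andbF.
under eq_bigr do rewrite andbT.
by rewrite -big_mkcond sum1_card e2.
Qed.

(** An edge receives the coefficients of its two orientations, hence at most 2,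
    and the squares of these sums add up to at most [2 Q]. *)
Lemma link_hoeffding (Q t : R) : (forall v u, `|coef v u| <= 1) ->
  0 < Q -> \sum_v \sum_u `|coef v u| <= Q -> 0 <= t ->
  bern_pr pair_pr (fun G => t <= link_dev G) <= expR (- (t ^+ 2 / (16 * Q))).
Proof.
move=> c1 Q0 cQ t0.
have abs_coef e : `|edge_coef e| <=
    \sum_v \sum_(u | u != v) `|coef v u| * ([set v; u]%SET == e)%:R.
  apply: le_trans (ler_norm_sum _ _ _) _; apply: ler_sum => v _.
  apply: le_trans (ler_norm_sum _ _ _) _; apply: ler_sum => u _.
  by rewrite normrM normr_nat.
have coef2 e : `|edge_coef e| <= 2.
  apply: le_trans (abs_coef e) (le_trans _ (two_ends e)).
  by apply: ler_sum => v _; apply: ler_sum => u _; rewrite ler_piMl.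
have sq : \sum_e edge_coef e ^+ 2 <= 2 * Q.
  apply: (@le_trans _ _ (\sum_e 2 * `|edge_coef e|)).
    by apply: ler_sum => e _; rewrite -(real_normK (num_real _)) expr2 ler_wpM2r.
  rewrite -mulr_sumr ler_pM2l //; apply: le_trans cQ.
  apply: (le_trans (ler_sum _ (fun e _ => abs_coef e))).
  rewrite exchange_big; apply: ler_sum => v _ /=.
  rewrite exchange_big big_mkcond; apply: ler_sum => u _ /=.
  case: ifP => // _.
  rewrite (bigD1 [set v; u]%SET) //= eqxx mulr1 big1 ?addr0 // => e /negbTE.
  by rewrite eq_sym => ->; rewrite mulr0.
have -> : 16 * Q = 8 * (2 * Q) by ring.
rewrite (_ : (fun G => t <= link_dev G) = (fun G => t <= bern_dev pair_pr edge_coef G)).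
  by apply: hoeffding => //; [exact: pair_pr01 | rewrite mulr_gt0].
by apply/funext => G; rewrite link_devE.
Qed.

End RandomGraph.

Lemma card_set_vertex n : #|{set vertex n}| = (2 ^ (2 * n))%N.
Proof.
have <- : #|vertex n| = (2 * n)%N by rewrite card_prod card_bool card_ord.
rewrite -[in RHS]cardsT -card_powerset; apply: eq_card => A.
by rewrite powersetE finset.subsetT.
Qed.

Section GoodGraphs.
Variables (R : realType) (n : nat) (p q : R).
Hypothesis n_gt0 : (0 < n)%N.
Hypotheses (q_gt0 : 0 < q) (q_le_p : q <= p) (p_le1 : p <= 1).
Implicit Types (A B : {set vertex n}) (u v : vertex n) (G : graph (vertex n)).

Let nR0 : 0 < n%:R :> R. Proof. by rewrite ltr0n. Qed.

Lemma degree_inE G A v :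
  degree_in R G A v = \sum_(u | u != v) ([set v; u]%SET \in G)%:R * opinion R A u.
Proof.
rewrite /degree_in -sum1_card natr_sum big_mkcond [RHS]big_mkcond.
apply: eq_bigr => u _; rewrite !inE /opinion.
by case: (_ != _); case: (_ \in G); case: (_ \in A); rewrite ?(mulr1, mulr0).
Qed.

Let signed_cut A B v u : R := (if v \in B then 1 else -1) * opinion R A u.
Let minus_star v0 v (u : vertex n) : R := - (v == v0)%:R.

Let unbalanced A B G :=
  24 * n%:R * Num.sqrt n%:R <= link_dev p q (signed_cut A B) G.
Let low_degree v G := q * n%:R / 2 <= link_dev p q (minus_star v) G.

Let good_of_bounds G : (forall A B, ~~ unbalanced A B G) ->
  (forall v, ~~ low_degree v G) -> good_graph p q G.
Proof.
have q0 := q_gt0; have qp := q_le_p; have p1 := p_le1; have n0 := nR0.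
have n1 : 1 <= n%:R :> R by rewrite ler1n.
have link01 v u : 0 <= link_pr p q v u <= 1 by rewrite /link_pr; case: ifP; lra.
move=> hcut hdeg; split=> [A|v].
  (* The signs of the errors turn the sum of absolute values into a linear
     statistic, up to the pairs (v, v), which are no edges and contribute at
     most 2 n. *)
  pose B := [set v | expected_degree_in p q A v <= degree_in R G A v]%SET.
  have := hcut A B; rewrite -ltNge /link_dev => hAB.
  have -> : \sum_v `|degree_in R G A v - expected_degree_in p q A v| =
     link_dev p q (signed_cut A B) G +
     \sum_v - ((if v \in B then 1 else -1) * (link_pr p q v v * opinion R A v)).
    rewrite -big_split; apply: eq_bigr => v _ /=.
    have -> : expected_degree_in p q A v =
       \sum_(u | u != v) link_pr p q v u * opinion R A u +
       link_pr p q v v * opinion R A v.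
      rewrite /expected_degree_in addrC -(bigD1 v (P := predT)) //= big_mkcond.
      apply: eq_bigr => u _; rewrite /opinion.
      by case: (_ \in A); rewrite ?(mulr1, mulr0).
    have -> : \sum_(u | u != v) signed_cut A B v u *
         (([set v; u]%SET \in G)%:R - link_pr p q v u) =
       (if v \in B then 1 else -1) * (degree_in R G A v -
        \sum_(u | u != v) link_pr p q v u * opinion R A u).
      rewrite degree_inE -sumrB mulr_sumr; apply: eq_bigr => u _.
      by rewrite /signed_cut; ring.
    set x := degree_in R G A v; set y := \sum_(u | _) _; set z := _ * opinion R A v.
    have : (v \in B) = (y + z <= x).
      rewrite inE /x /y /z /expected_degree_in addrC -(bigD1 v (P := predT)) //=.
      rewrite big_mkcond; congr (_ <= _); apply: eq_bigr => u _; rewrite /opinion.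
      by case: (_ \in A); rewrite ?(mulr1, mulr0).
    move=> ->; case: leP => h.
      by rewrite ger0_norm ?subr_ge0 //; ring.
    by rewrite ltr0_norm ?subr_lt0 //; ring.
  have diag : \sum_v - ((if v \in B then 1 else -1) * (link_pr p q v v * opinion R A v))
     <= 2 * n%:R.
    apply: (@le_trans _ _ (\sum_(v : vertex n) 1)).
      apply: ler_sum => v _; have := link01 v v; rewrite /opinion.
      by case: (_ \in B); case: (_ \in A); rewrite ?(mulr1, mulr0) /=; lra.
    by rewrite sumr_const card_prod card_bool card_ord natrM.
  have root : 1 <= Num.sqrt n%:R :> R by rewrite -[leLHS]sqrtr1 ler_wsqrtr.
  have : n%:R <= n%:R * Num.sqrt n%:R :> R by rewrite ler_peMr // ltW.
  have := ltW hAB; rewrite -/(link_dev _ _ _ _); lra.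
have := hdeg v; rewrite -ltNge /low_degree /link_dev.
rewrite (bigD1 v) //= [X in _ + X]big1 => [|v' /negbTE v'v]; last first.
  by rewrite big1 // => u _; rewrite /minus_star v'v oppr0 mul0r.
rewrite addr0.
have -> : \sum_(u | u != v) minus_star v v u *
     (([set v; u]%SET \in G)%:R - link_pr p q v u) =
   \sum_(u | u != v) link_pr p q v u - degree_in R G finset.setT v.
  rewrite degree_inE -sumrB; apply: eq_bigr => u _.
  by rewrite /minus_star eqxx /opinion finset.in_setT /=; ring.
have : q * (2 * n%:R - 1) <= \sum_(u | u != v) link_pr p q v u.
  apply: (@le_trans _ _ (\sum_(u | u != v) q)); last first.
    by apply: ler_sum => u _; rewrite /link_pr; case: ifP.
  have : \sum_(u : vertex n) q = q * (2 * n%:R).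
    by rewrite sumr_const card_prod card_bool card_ord -[LHS]mulr_natr natrM.
  by rewrite (bigD1 v) //=; lra.
by have : q * 1 <= q * n%:R; [rewrite ler_wpM2l // ltW | lra].
Qed.

Let unbalanced_pr A B :
  bern_pr (pair_pr p q) (unbalanced A B) <= expR (- (9 * n%:R)).
Proof.
have n0 := nR0.
apply: le_trans (link_hoeffding (Q := 4 * n%:R ^+ 2) _ _ _ _ _ _ _) _ => //.
- move=> v u; rewrite /signed_cut /opinion.
  by case: (_ \in B); case: (_ \in A); rewrite ?(mulr1, mulr0) ?normrN ?normr1 ?normr0.
- by rewrite mulr_gt0 ?exprn_gt0.
- apply: (@le_trans _ _ (\sum_(v : vertex n) \sum_(u : vertex n) 1)).
    apply: ler_sum => v _; apply: ler_sum => u _; rewrite /signed_cut /opinion.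
    by case: (_ \in B); case: (_ \in A); rewrite ?(mulr1, mulr0) ?normrN ?normr1 ?normr0.
  rewrite !sumr_const card_prod card_bool card_ord -[leLHS]mulr_natr natrM.
  by rewrite le_eqVlt; apply/orP; left; apply/eqP; ring.
rewrite ler_expR lerN2 exprMn sqr_sqrtr // le_eqVlt; apply/orP; left; apply/eqP.
by field; rewrite gt_eqF.
Qed.

Let low_degree_pr v :
  bern_pr (pair_pr p q) (low_degree v) <= expR (- (q ^+ 2 / 128 * n%:R)).
Proof.
have n0 := nR0; have q0 := q_gt0.
apply: le_trans (link_hoeffding (Q := 2 * n%:R) _ _ _ _ _ _ _) _ => //.
- by move=> x u; rewrite /minus_star normrN; case: eqP; rewrite ?normr1 ?normr0.
- by rewrite mulr_gt0.
- rewrite (bigD1 v) //= [X in _ + X]big1 => [|v' /negbTE v'v]; last first.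
    by rewrite big1 // => u _; rewrite /minus_star v'v oppr0 normr0.
  rewrite addr0 /minus_star eqxx normrN normr1.
  by rewrite sumr_const card_prod card_bool card_ord natrM.
- by rewrite !mulr_ge0 // ltW.
rewrite ler_expR lerN2 le_eqVlt; apply/orP; left; apply/eqP.
by field; rewrite gt_eqF.
Qed.

(** For the first clause of [good_graph], the union bound runs over 4^n sets A
    and 4^n sets of vertices with a nonnegative error, each event having
    probability at most exp (- 9 n). *)
Lemma good_graph_pr : 24 * (128 / q ^+ 2) ^+ 3 <= n%:R ->
  1 - n%:R^-1 <= sbm_pr p q (@good_graph R n p q).
Proof.
have n0 := nR0; have q0 := q_gt0.
move=> n_large; rewrite sbm_prE.
pose bad G : R := \sum_A \sum_B (unbalanced A B G)%:R + \sum_v (low_degree v G)%:R.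
have pw G : 1 + (-1) * bad G <= `[< good_graph p q G >]%:R.
  case: asboolP => [_|ngood] /=.
    rewrite mulN1r gerDl oppr_le0 addr_ge0 ?sumr_ge0 // => A _.
      by rewrite sumr_ge0.
  rewrite mulN1r subr_le0; apply: contra_notT ngood; rewrite -ltNge => bad1.
  apply: good_of_bounds => [A B|v]; apply/negP => hbad; move: bad1; apply/negP;
    rewrite -leNgt /bad.
    rewrite (bigD1 A) //= (bigD1 B) //= hbad -!addrA lerDl.
    by rewrite !addr_ge0 ?sumr_ge0 // => *; rewrite sumr_ge0.
  rewrite [X in _ + X](bigD1 v) //= hbad addrCA lerDl.
  by rewrite !addr_ge0 ?sumr_ge0 // => *; rewrite sumr_ge0.
have P01 := pair_pr01 q_gt0 q_le_p p_le1.
apply: le_trans (le_bern_exp (P01 n) pw); rewrite bern_expD bern_exp_cst bern_expZ.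
rewrite mulN1r lerD2l lerN2 bern_expD !bern_exp_sum.
have cut : \sum_A bern_exp (@pair_pr R n p q) (fun G => \sum_B (unbalanced A B G)%:R) <=
    (2 * n%:R)^-1.
  apply: (@le_trans _ _ (\sum_(A : {set vertex n}) \sum_(B : {set vertex n}) expR (- (9 * n%:R)))).
    apply: ler_sum => A _; rewrite bern_exp_sum; apply: ler_sum => B _.
    exact: unbalanced_pr.
  rewrite !sumr_const card_set_vertex -!mulrnA -[leLHS]mulr_natl natrM natrX.
  have two : 2 <= expR 1 :> R by have := expR_ge1Dx (1 : R); lra.
  have pw2 : 2 ^+ (2 * n) <= expR (2 * n%:R) :> R.
    rewrite -(mulr1 (2 * n%:R)) -natrM expRM_natl.
    by rewrite ler_pXn2r ?nnegrE ?expR_ge0 ?muln_gt0.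
  have h : expR (- (9 * n%:R)) * (expR (2 * n%:R) * expR (2 * n%:R)) <= (2 * n%:R)^-1 :> R.
    rewrite -!expRD (_ : _ + _ = - (5 * n%:R)); last by ring.
    rewrite expRN lef_pV2 ?posrE ?expR_gt0 ?mulr_gt0 //.
    by apply: le_trans (expR_ge1Dx _); lra.
  by rewrite [leLHS]mulrC; apply: le_trans h; rewrite ler_wpM2l ?expR_ge0 // ler_pM.
have low : \sum_v bern_exp (@pair_pr R n p q) (fun G => (low_degree v G)%:R) <= (2 * n%:R)^-1.
  apply: (le_trans (ler_sum _ (fun v _ => low_degree_pr v))).
  rewrite sumr_const card_prod card_bool card_ord -[leLHS]mulr_natl natrM.
  set a := 128 / q ^+ 2 in n_large.
  have a0 : 0 < a by rewrite divr_gt0 ?exprn_gt0.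
  have -> : q ^+ 2 / 128 * n%:R = n%:R / a by rewrite /a; field; rewrite gt_eqF.
  have := expRN_cube_le (divr_gt0 n0 a0) => h.
  apply: (@le_trans _ _ (2 * n%:R * (6 / (n%:R / a) ^+ 3))).
    by rewrite ler_wpM2l // mulr_ge0 // ltW.
  have -> : 2 * n%:R * (6 / (n%:R / a) ^+ 3) = (24 * a ^+ 3) / n%:R / (2 * n%:R).
    by field; rewrite !gt_eqF.
  rewrite -[leRHS]mul1r; apply: ler_wpM2r; first by rewrite invr_ge0 mulr_ge0 // ltW.
  by rewrite ler_pdivrMr // mul1r.
apply: le_trans (lerD cut low) _; rewrite le_eqVlt; apply/orP; left; apply/eqP.
by field; rewrite gt_eqF.
Qed.

End GoodGraphs.

(** * Fluctuations of one step *)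

(** Raising the chances of at least [n] coordinates by (L + 4) / sqrt n moves
    the mean of the sum to (L + 4) sqrt n or more, and Hoeffding's inequality keeps
    the sum above L sqrt n with probability at least one half.  The chi-square cost of the change
    does not depend on [n]. *)
Lemma bern_anticoncentration (R : realType) (I : finType) (P : I -> R)
    (D : {set I}) (n : nat) (k L : R) :
  (0 < n)%N -> (#|I| <= 2 * n)%N -> (n <= #|D|)%N ->
  (forall i, 0 <= P i <= 1) -> 0 < k ->
  (forall i, i \in D -> k <= P i <= 1 - k) ->
  0 <= L -> (L + 4) / Num.sqrt n%:R <= k / 2 ->
  1 / (4 * expR (4 * (L + 4) ^+ 2 / k)) <=
  bern_pr P (fun B => L * Num.sqrt n%:R <= bern_dev P (fun=> 1) B).
Proof.
move=> n_gt0 In nD P01 k0 PD L0.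
have n0 : 0 < n%:R :> R by rewrite ltr0n.
have r0 : 0 < Num.sqrt n%:R :> R by rewrite sqrtr_gt0.
have rr : Num.sqrt n%:R * Num.sqrt n%:R = n%:R :> R by rewrite -expr2 sqr_sqrtr // ltW.
set r : R := Num.sqrt n%:R in r0 rr *; set d := (L + 4) / r => dk.
have d0 : 0 < d by rewrite divr_gt0 //; lra.
have rd : d * r = L + 4 by rewrite /d mulfVK // gt_eqF.
have n_d : n%:R * d = (L + 4) * r by rewrite -rr -mulrA [r * d]mulrC rd mulrC.
have nd2 : n%:R * d ^+ 2 = (L + 4) ^+ 2 by rewrite -rr -rd; ring.
pose P' i := if i \in D then P i + d else P i.
have P'01 i : 0 <= P' i <= 1.
  by rewrite /P'; have := P01 i; case: ifP => [/PD|_]; lra.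
apply: (bern_change_of_measure (P' := P')) => //.
- move=> i Pi; rewrite /P'; case: ifP => // /PD; rewrite Pi; lra.
- move=> i Pi; rewrite /P'; case: ifP => // /PD; rewrite Pi; lra.
- exact: expR_gt0.
- apply: (@le_trans _ _ (\prod_(i : I) expR (2 * d ^+ 2 / k))).
    apply: ler_prod => i _; have /andP[Pi0 Pi1] := P01 i.
    have P'i := P'01 i; apply/andP; split.
      by rewrite addr_ge0 // divr_ge0 ?sqr_ge0 //; lra.
    have e1 : 1 <= expR (2 * d ^+ 2 / k).
      apply: le_trans (expR_ge1Dx _); rewrite lerDl.
      by apply: divr_ge0; [apply: mulr_ge0 => //; exact: sqr_ge0 | exact: ltW].
    move: P'i; rewrite /P'; case: ifPn => iD P'i; last first.
      apply: le_trans e1; rewrite !expr2 -!mulrA.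
      have div_le1 (x : R) : x / x <= 1.
        by have [->|x0] := eqVneq x 0; [rewrite mul0r | rewrite divff].
      have Q0 : 0 <= 1 - P i by lra.
      by have := ler_wpM2l Pi0 (div_le1 (P i)); have := ler_wpM2l Q0 (div_le1 (1 - P i)); lra.
    have /andP[Pk Pk'] := PD i iD.
    apply: le_trans (expR_ge1Dx _).
    have -> : (P i + d) ^+ 2 / P i + (1 - (P i + d)) ^+ 2 / (1 - P i) =
        1 + d ^+ 2 / (P i * (1 - P i)).
      by field; apply/andP; split; rewrite gt_eqF //; lra.
    have -> : 2 * d ^+ 2 / k = d ^+ 2 * (2 / k) by ring.
    rewrite lerD2l; apply: ler_wpM2l; first exact: sqr_ge0.
    have PP : k / 2 <= P i * (1 - P i) by have [h|h] := leP (P i) (1 / 2); nra.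
    have k2 : 0 < k / 2 by lra.
    by rewrite -[2 / k]invf_div lef_pV2 ?posrE //; lra.
  rewrite -expR_sum ler_expR sumr_const -[leLHS]mulr_natl.
  apply: (@le_trans _ _ ((2 * n%:R) * (2 * d ^+ 2 / k))).
    apply: ler_wpM2r; last by rewrite -natrM ler_nat.
    by apply: divr_ge0; [apply: mulr_ge0 => //; exact: sqr_ge0 | exact: ltW].
  rewrite le_eqVlt; apply/orP; left; apply/eqP; rewrite -nd2.
  by field; rewrite gt_eqF.
(* Under P', the sum is below its mean by 4 sqrt n with chance at most
   exp (-1). *)
- have Q0 : 0 < 2 * n%:R :> R by rewrite mulr_gt0.
  have t0 : 0 <= 4 * r by rewrite mulr_ge0 // ltW.
  have cQ : \sum_(i : I) (-1) ^+ 2 <= 2 * n%:R :> R.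
    rewrite sqrrN expr1n sumr_const -natrM.
    by rewrite ler_nat.
  have := hoeffding (c := fun=> -1) P'01 Q0 t0 cQ.
  have -> : - ((4 * r) ^+ 2 / (8 * (2 * n%:R))) = -1.
    by rewrite -rr; field; rewrite gt_eqF.
  move=> h.
  have e12 : expR (-1) <= 1 / 2 :> R.
    rewrite expRN mul1r lef_pV2 ?posrE ?expR_gt0 //.
    by have := expR_ge1Dx (1 : R); lra.
  have : 1 / 2 <= bern_pr P' (predC (fun B => 4 * r <= bern_dev P' (fun=> -1) B)).
    by rewrite bern_prC //; lra.
  move=> h2; apply: le_trans h2 _; apply: le_bern_pr => // B /=.
  rewrite -ltNge => hB.
  have -> : bern_dev P (fun=> 1) B = - bern_dev P' (fun=> -1) B + \sum_(i in D) d.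
    rewrite /bern_dev -sumrN [X in _ + X]big_mkcond -big_split /=.
    by apply: eq_bigr => i _; rewrite /P'; case: ifP => _; ring.
  have : n%:R * d <= \sum_(i in D) d.
    by rewrite sumr_const -[leRHS]mulr_natl ler_wpM2r ?(ltW d0) // ler_nat.
  by rewrite n_d; lra.
Qed.

Section Concentration.
Variables (R : realType) (n : nat) (P : vertex n -> R).
Hypothesis n_gt0 : (0 < n)%N.
Hypothesis P01 : forall v, 0 <= P v <= 1.

Let nR0 : 0 < n%:R :> R. Proof. by rewrite ltr0n. Qed.

Lemma mean_sum_dev (B : {set vertex n}) :
  bias R B - mean_sum P = bern_dev P (fun=> n%:R^-1) B.
Proof.
rewrite /bias /mean_sum /bern_dev -mulr_sumr sumrB mulrBr !(mulrC n%:R^-1).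
by rewrite /opinion; ring.
Qed.

Lemma mean_diff_dev (B : {set vertex n}) :
  disparity R B - mean_diff P = bern_dev P (fun v => block_sign R v / n%:R) B.
Proof.
rewrite /disparity /mean_diff -mulrBl -sumrB mulr_suml; apply: eq_bigr => v _.
by rewrite /opinion; ring.
Qed.

Lemma bern_exp_bias :
  bern_exp P (fun B => 1 + bias R B) = 1 + mean_sum P.
Proof.
rewrite bern_expD bern_exp_cst; congr (1 + _); rewrite /mean_sum.
have -> : bern_exp P (bias R (n := n)) =
    bern_exp P (fun B => n%:R^-1 * (\sum_v opinion R B v) + -1).
  by apply: eq_bigr => B _; rewrite /bias /mean_sum [n%:R^-1 * _]mulrC.
rewrite bern_expD bern_exp_cst bern_expZ bern_exp_sum [n%:R^-1 * _]mulrC.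
congr (_ / _ - 1); apply: eq_bigr => v _; exact: bern_pr_in.
Qed.

Let rate_eq (t : R) : t ^+ 2 / (8 * (2 / n%:R)) = t ^+ 2 / 16 * n%:R.
Proof. by have n0 := nR0; field; rewrite gt_eqF. Qed.

Let sum_sq : \sum_(v : vertex n) (n%:R^-1 : R) ^+ 2 <= 2 / n%:R.
Proof.
rewrite sumr_const card_prod card_bool card_ord -[leLHS]mulr_natl natrM.
have n0 := nR0; rewrite le_eqVlt; apply/orP; left; apply/eqP.
by field; rewrite gt_eqF.
Qed.

Lemma bias_concentration (t : R) : 0 <= t ->
  bern_pr P (fun B => t <= `|bias R B - mean_sum P|) <=
  2 * expR (- (t ^+ 2 / 16 * n%:R)).
Proof.
move=> t0; have n0 := nR0.
have Q0 : 0 < 2 / n%:R :> R by rewrite divr_gt0.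
have := hoeffding_abs (c := fun=> n%:R^-1) P01 Q0 t0 sum_sq.
rewrite rate_eq; apply: le_trans; apply: le_bern_pr => // B.
by rewrite mean_sum_dev.
Qed.

Lemma disparity_concentration (t : R) : 0 <= t ->
  bern_pr P (fun B => t <= `|disparity R B - mean_diff P|) <=
  2 * expR (- (t ^+ 2 / 16 * n%:R)).
Proof.
move=> t0; have n0 := nR0.
have Q0 : 0 < 2 / n%:R :> R by rewrite divr_gt0.
have cQ : \sum_(v : vertex n) (block_sign R v / n%:R) ^+ 2 <= 2 / n%:R.
  apply: (@le_trans _ _ (\sum_(v : vertex n) (n%:R^-1) ^+ 2)); last exact: sum_sq.
  apply: ler_sum => v _.
  by rewrite exprMn /block_sign; case: ifP; rewrite ?sqrrN expr1n mul1r.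
have := hoeffding_abs (c := fun v => block_sign R v / n%:R) P01 Q0 t0 cQ.
rewrite rate_eq; apply: le_trans; apply: le_bern_pr => // B.
by rewrite mean_diff_dev.
Qed.

End Concentration.

(** * Contraction of the potential *)

Section Constants.
Variables (R : realType) (p q : R).

Let w := contrast p q.
Let gam := gap w.
Let kap := kappa w.

(** Biases with |s| > 1 - end_width count as close to consensus; there the
    expected potential is at most (8 + 4 kappa) (12 end_width / q^2) = 1 / 2 times
    the minority fraction, up to the noise. *)
Definition end_width : R := q ^+ 2 / (24 * (8 + 4 * kap)).
Definition mid_rate : R := rate w end_width.
(** The fluctuation of m' that is tolerated in one step. *)
Definition noise_level : R := end_width * gam / 144.
(** The potential is cut off at [cap_slope * n].  The slope must be so small
    that, wherever there is no cut-off, both the error of the drift and the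
    fluctuation of s' are a small fraction of |s|; see the two lemmas on it
    below. *)
Definition cap_slope : R :=
  mid_rate * end_width * (mid_rate / 4) ^+ 2 / (8 * 32 ^+ 2 * drift_error p q ^+ 2).

Hypotheses (q_gt0 : 0 < q) (q_le_p : q <= p) (p_le1 : p <= 1).
Hypothesis gap_gt0 : 0 < gap (contrast p q).

Let w0 : 0 <= w. Proof. by have /andP[] := contrast01 q_gt0 q_le_p. Qed.

Lemma drift_error_ge1 : 1 <= drift_error p q.
Proof.
have q0 := q_gt0; have qp := q_le_p; have p1 := p_le1.
by rewrite /drift_error ler_pdivlMr; lra.
Qed.

Lemma end_width_bounds : 0 < end_width <= 1 / 100.
Proof.
have q0 := q_gt0; have qp := q_le_p; have p1 := p_le1.
have k12 : 12 <= kap := kappa_ge12 w0 gap_gt0.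
have d0 : 0 < 24 * (8 + 4 * kap) by lra.
rewrite /end_width divr_gt0 ?exprn_gt0 //= ler_pdivrMr //; nra.
Qed.

Lemma mid_rate_bounds : 0 < mid_rate <= 1.
Proof.
have /andP[e0 e1] := end_width_bounds.
have k12 : 12 <= kap := kappa_ge12 w0 gap_gt0.
have d0 : 0 < 9 * (1 + kap) by lra.
rewrite /mid_rate /rate -/kap; apply/andP; split; last by rewrite ler_pdivrMr //; lra.
by apply: divr_gt0 => //; lra.
Qed.

Lemma noise_level_bounds :
  [/\ 0 < noise_level, 2 * noise_level <= gam / 24 &
      3 * kap * (2 * noise_level) <= end_width / 2].
Proof.
have /andP[e0 e1] := end_width_bounds.
have g0 : 0 < gam := gap_gt0.
have kg : kap * gam = 12 by rewrite /kap /kappa mulfVK // gt_eqF.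
rewrite /noise_level; split.
- by apply: divr_gt0 => //; apply: mulr_gt0.
- by nra.
- have -> : 3 * kap * (2 * (end_width * gam / 144)) = 
     (kap * gam) * end_width / 24 by field.
  by rewrite kg; lra.
Qed.

Lemma cap_slope_gt0 : 0 < cap_slope.
Proof.
have /andP[e0 _] := end_width_bounds; have /andP[z0 _] := mid_rate_bounds.
have B1 := drift_error_ge1.
apply: divr_gt0; last by apply: mulr_gt0; [rewrite mulr_gt0 ?exprn_gt0 | apply: exprn_gt0; lra].
by apply: mulr_gt0; [exact: mulr_gt0 | apply: exprn_gt0; lra].
Qed.

Lemma cap_slope_drift : 32 * cap_slope * drift_error p q ^+ 2 <= (mid_rate / 4) ^+ 2.
Proof.
have /andP[e0 e1] := end_width_bounds; have /andP[z0 z1] := mid_rate_bounds.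
have B1 := drift_error_ge1.
have -> : 32 * cap_slope * drift_error p q ^+ 2 =
   mid_rate * end_width / 256 * (mid_rate / 4) ^+ 2.
  by rewrite /cap_slope; field; lra.
have ze1 : mid_rate * end_width <= 1 by nra.
by apply: ler_piMl; [exact: sqr_ge0 | lra].
Qed.

Lemma cap_slope_noise :
  32 ^+ 2 * cap_slope / (mid_rate / 4) ^+ 2 <= mid_rate * end_width / 8.
Proof.
have /andP[e0 e1] := end_width_bounds; have /andP[z0 z1] := mid_rate_bounds.
have B1 := drift_error_ge1.
have -> : 32 ^+ 2 * cap_slope / (mid_rate / 4) ^+ 2 =
   mid_rate * end_width / 8 * (drift_error p q ^+ 2)^-1.
  by rewrite /cap_slope; field; apply/andP; split; lra.
have ze0 : 0 < mid_rate * end_width by apply: mulr_gt0.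
apply: ler_piMr; first lra.
by rewrite invf_le1 ?exprn_ege1 // exprn_gt0 //; lra.
Qed.

(** In the trap, the potential is cut off only where |s| is below
    [core_reach / sqrt n]; from there on it is at most half of the cut-off. *)
Definition core_reach : R :=
  Num.sqrt (2 * (1 + kap) / cap_slope).
(** In units of n^(-1/2): in the core the drift takes the bias at most
    3 / 2 core_reach below zero, and the fluctuation has to lift it from there to
    core_reach and to make up for the drift error. *)
Definition core_dev : R := 5 / 2 * core_reach + drift_error p q.
Definition core_escape : R := 1 / (4 * expR (4 * (core_dev + 4) ^+ 2 / (1 / 100))).

Lemma core_dev_ge0 : 0 <= core_dev.
Proof.
have B1 := drift_error_ge1.
have : 0 <= core_reach by apply: sqrtr_ge0.
by rewrite /core_dev; lra.
Qed.

End Constants.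

Section OneStepContraction.
Variables (R : realType) (n : nat) (p q : R).
Hypothesis n_gt0 : (0 < n)%N.
Hypotheses (q_gt0 : 0 < q) (q_le_p : q <= p) (p_le1 : p <= 1).
Hypothesis gap_gt0 : 0 < gap (contrast p q).
Variable G : graph (vertex n).
Hypothesis goodG : good_graph p q G.
Variable A : {set vertex n}.
Implicit Type B : {set vertex n}.

Let w := contrast p q.
Let gam := gap w.
Let kap := kappa w.
Let e1 := noise_level p q.
Let eps := end_width p q.
Let cap := cap_slope p q * n%:R.
Let P := adopt1_pr R G A.
Let s := bias R A.
Let m := disparity R A.

Definition potential B : R :=
  lyap (contrast p q) (cap_slope p q * n%:R) (bias R B) (disparity R B).

(** Bounds the chance that m' fluctuates by more than [noise_level]. *)
Definition tail_bound : R := 2 * expR (- (noise_level p q ^+ 2 / 16 * n%:R)).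

Let nR0 : 0 < n%:R :> R. Proof. by rewrite ltr0n. Qed.
Let w0 : 0 <= w. Proof. by have /andP[] := contrast01 q_gt0 q_le_p. Qed.
Let P01 v : 0 <= P v <= 1. Proof. exact: adopt1_pr01. Qed.
Let cap0 : 0 < cap.
Proof. by rewrite mulr_gt0 ?cap_slope_gt0. Qed.
Let sm1 B : `|bias R B| + `|disparity R B| <= 1.
Proof. exact: bias_disparity_le1. Qed.
Let potential_le2 B : potential B <= 2 * cap.
Proof.
apply: lyap_le2 => //; first exact: ltW.
by have := sm1 B; have := normr_ge0 (bias R B); lra.
Qed.

Hypothesis drift_small : drift_error p q / Num.sqrt n%:R <= noise_level p q.

Let off_diff B := e1 <= `|disparity R B - mean_diff P|.

Let off_diff_pr : bern_pr P off_diff <= tail_bound.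
Proof.
apply: disparity_concentration => //; apply: ltW.
by have [] := noise_level_bounds q_gt0 q_le_p p_le1 gap_gt0.
Qed.

Let next_disparity B : ~~ off_diff B ->
  `|disparity R B| <= `|drift_diff w s m| + 2 * e1.
Proof.
rewrite /off_diff -ltNge => h.
have h2 := mean_diff_drift n_gt0 q_gt0 q_le_p goodG A.
have h3 := drift_small.
have -> : disparity R B = (disparity R B - mean_diff P) +
  (mean_diff P - drift_diff w s m) + drift_diff w s m by ring.
apply: le_trans (ler_normD _ _) _.
have h4 := ler_normD (disparity R B - mean_diff P) (mean_diff P - drift_diff w s m).
by move: h h2 h3 h4; rewrite -/P -/s -/m -/w -/e1; lra.
Qed.

Let trap_next B : m ^+ 2 <= trap w -> ~~ off_diff B -> disparity R B ^+ 2 <= trap w.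
Proof.
move=> mt ok; have [e10 e1g _] := noise_level_bounds q_gt0 q_le_p p_le1 gap_gt0.
apply: (trap_stable (s := s) (e := 2 * e1) w0 gap_gt0 _ mt (next_disparity ok)).
  exact: sm1.
have := gap_gt0; rewrite -/w -/gam => g0.
by move: e1g; rewrite -/e1 -/w -/gam; lra.
Qed.

Ltac arith_context := clear -R n p q n_gt0 q_gt0 q_le_p p_le1 gap_gt0 G goodG A
  w gam kap e1 eps cap P s m nR0 w0 P01 cap0 sm1 potential_le2 drift_small
  off_diff off_diff_pr next_disparity trap_next.

(** The disparity loses a constant, and so does the potential relative to the
    cut-off; entering the trap loses even more. *)
Lemma contract_outside : trap w < m ^+ 2 -> tail_bound <= gam / 192 ->
  bern_exp P potential <= (1 - gam / 96) * potential A.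
Proof.
move=> out small.
have g0 : 0 < gam := gap_gt0.
have g1 : gam <= 1 := gap_le1 w0 gap_gt0.
have [e10 e1g _] := noise_level_bounds q_gt0 q_le_p p_le1 gap_gt0.
have c0 := cap0.
have sm := sm1 A.
have t1 := trap_ge_half w0 gap_gt0; have s0 := normr_ge0 (bias R A).
have VA : potential A = cap * (1 + `|m|).
  by rewrite /potential /lyap ifN // -ltNge.
have m1 : `|m| <= 1 by rewrite /m; lra.
have m0 : 1 / 2 <= `|m|.
  have : 1 / 2 < m ^+ 2 by apply: le_lt_trans out.
  by rewrite -(real_normK (num_real m)); have := normr_ge0 m; nra.
have dd : `|drift_diff w s m| <= `|m| - gam / 12.
  by apply: drift_diff_le => //; rewrite real_normK ?num_real ?ltW.
have VA0 : 0 < potential A by rewrite VA mulr_gt0 //; lra.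
have pw B : potential B <= (1 - gam / 48) * potential A + 2 * potential A * (off_diff B)%:R
    + 0 * (off_diff B)%:R.
  rewrite mul0r addr0.
  case: (boolP (off_diff B)) => bad /=.
    have := potential_le2 B; rewrite mulr1.
    have : cap <= potential A by rewrite VA; nra.
    have : 0 <= (1 - gam / 48) * potential A by rewrite mulr_ge0 //; lra.
    by lra.
  rewrite mulr0 addr0.
  have nd := next_disparity bad.
  have md : `|disparity R B| <= `|m| - gam / 24.
    by move: e1g; rewrite -/w -/gam -/e1; lra.
  rewrite VA; have [inside|outside] := leP (disparity R B ^+ 2) (trap w).
    have h := lyap_le_cap w0 gap_gt0 (bias R B) (ltW cap0) inside.
    apply: (le_trans h); rewrite -/cap.
    have hh : 1 <= (1 - gam / 48) * (1 + `|m|) by nra.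
    by have := ler_wpM2l (ltW cap0) hh; lra.
  rewrite /potential /lyap ifN -?ltNge // -/cap.
  have hh : 1 + `|disparity R B| <= (1 - gam / 48) * (1 + `|m|) by nra.
  by have := ler_wpM2l (ltW cap0) hh; lra.
apply: le_trans (bern_exp_le_events P01 pw) _; rewrite mul0r addr0.
have h : 2 * potential A * bern_pr P off_diff <= 2 * potential A * (gam / 192).
  by apply: ler_wpM2l; [lra | exact: le_trans off_diff_pr small].
lra.
Qed.

(** Since the potential is not cut off, s^2 is at least of order 1 / n.  A
    fluctuation of order |s| has probability O(1 / (n s^2)) and then costs at most
    twice the cut-off, in total O(cap_slope / s^2); as the potential is at least
    end_width / s^2, a small slope makes this negligible. *)
Lemma contract_middle : m ^+ 2 <= trap w -> 1 + kap * m ^+ 2 < s ^+ 2 * (cap + 1) ->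
  `|s| <= 1 - eps -> 1 <= cap -> 2 * cap * tail_bound <= mid_rate p q * eps / 8 ->
  bern_exp P potential <= (1 - mid_rate p q / 4) * potential A.
Proof.
move=> mt uncapped s_eps cap1 small.
have g0 : 0 < gam := gap_gt0.
have [e10 e1g e1k] := noise_level_bounds q_gt0 q_le_p p_le1 gap_gt0.
have /andP[z0 z1] := mid_rate_bounds q_gt0 q_le_p p_le1 gap_gt0.
have /andP[eps0 eps1] := end_width_bounds q_gt0 q_le_p p_le1 gap_gt0.
have th0 := cap_slope_gt0 q_gt0 q_le_p p_le1 gap_gt0.
have thB := cap_slope_drift q_gt0 q_le_p p_le1 gap_gt0.
have thN := cap_slope_noise q_gt0 q_le_p p_le1 gap_gt0.
have B1 := drift_error_ge1 q_gt0 q_le_p p_le1.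
have k12 : 12 <= kap := kappa_ge12 w0 gap_gt0.
have c0 := cap0; have n0 := nR0; have sm : `|s| + `|m| <= 1 := sm1 A.
rewrite -/eps in eps0 eps1 thN small.
set z := mid_rate p q in z0 z1 thB thN small *.
set th := cap_slope p q in th0 thB thN.
set tau := z / 4 in thB thN.
have tau0 : 0 < tau by rewrite /tau; lra.
have capE : cap = th * n%:R by [].
have km0 : 0 <= kap * m ^+ 2 by apply: mulr_ge0; [lra | exact: sqr_ge0].
have S0 : 0 < s ^+ 2 by have := sqr_ge0 s; nra.
have s_neq0 : s != 0 by have := S0; rewrite exprn_even_gt0.
have as0 : 0 < `|s| by rewrite normr_gt0.
have S_eps : eps <= 1 - s ^+ 2.
  by rewrite -(real_normK (num_real s)); move: as0 s_eps eps0 eps1; arith_context; nra.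
have VA : potential A = (1 + kap * m ^+ 2) / s ^+ 2 - 1.
  by rewrite /potential /lyap ifT // ifN // -ltNge.
have VAS : potential A * s ^+ 2 = 1 + kap * m ^+ 2 - s ^+ 2.
  by rewrite VA mulrBl mul1r mulfVK // gt_eqF.
have S1 : s ^+ 2 <= 1 by move: S_eps eps0; arith_context; lra.
have VS : eps / s ^+ 2 <= potential A by rewrite ler_pdivrMr // VAS; move: S_eps km0; arith_context; lra.
have Veps : eps <= potential A.
  by apply: le_trans VS; rewrite ler_pdivlMr // ler_piMr // (ltW eps0).
pose off_sum B := tau / 4 * `|s| <= `|bias R B - mean_sum P|.
have off_sum_pr : 2 * cap * bern_pr P off_sum <= z / 8 * potential A.
  have t0 : 0 <= tau / 4 * `|s| by apply: mulr_ge0 => //; move: tau0; arith_context; lra.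
  have h := bias_concentration n_gt0 P01 t0.
  pose y := (tau / 4 * `|s|) ^+ 2 / 16 * n%:R.
  have yE : y = tau ^+ 2 * s ^+ 2 * n%:R / 16 ^+ 2.
    by rewrite /y exprMn (real_normK (num_real s)); field.
  have y0 : 0 < y.
    rewrite yE; apply: divr_gt0 => //; apply: mulr_gt0 => //.
    by apply: mulr_gt0 => //; exact: exprn_gt0.
  have h2 : bern_pr P off_sum <= 2 * y^-1.
    by apply: (le_trans h); apply: ler_wpM2l => //; exact: expRN_le_inv.
  have c20 : 0 <= 2 * cap by move: c0; arith_context; lra.
  apply: (le_trans (ler_wpM2l c20 h2)).
  have -> : 2 * cap * (2 * y^-1) = 32 ^+ 2 * th / tau ^+ 2 / s ^+ 2.
    by rewrite yE capE; field; rewrite ?s_neq0 ?(gt_eqF n0) ?(gt_eqF tau0).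
  have h3 : 32 ^+ 2 * th / tau ^+ 2 / s ^+ 2 <= z * eps / 8 / s ^+ 2.
    by apply: ler_wpM2r => //; rewrite invr_ge0 ltW.
  apply: (le_trans h3).
  have -> : z * eps / 8 / s ^+ 2 = z / 8 * (eps / s ^+ 2) by ring.
  by apply: ler_wpM2l => //; move: z0; arith_context; lra.
have drift_tau : drift_error p q / Num.sqrt n%:R <= tau / 4 * `|s|.
  rewrite -(@ler_pXn2r _ 2) ?nnegrE //; last 2 first.
  - by apply: divr_ge0; [move: B1; arith_context; lra | exact: sqrtr_ge0].
  - by apply: mulr_ge0 => //; move: tau0; arith_context; lra.
  rewrite expr_div_n (sqr_sqrtr (ltW n0)) ler_pdivrMr //.
  rewrite [(_ * `|s|) ^+ 2]exprMn (real_normK (num_real s)).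
  have h : 1 <= 2 * th * n%:R * s ^+ 2 by move: uncapped; rewrite capE in cap1 *; nra.
  have h4 := ler_wpM2l (sqr_ge0 (drift_error p q)) h.
  have h5 := ler_wpM2r (ltW (mulr_gt0 n0 S0)) thB.
  have -> : (tau / 4) ^+ 2 * s ^+ 2 * n%:R = tau ^+ 2 * (n%:R * s ^+ 2) / 16 by field.
  move: h4 h5; rewrite mulr1.
  have -> : 32 * th * drift_error p q ^+ 2 * (n%:R * s ^+ 2) =
     16 * (drift_error p q ^+ 2 * (2 * th * n%:R * s ^+ 2)) by ring.
  arith_context; lra.
have half : `|s| / 2 <= `|drift_sum w s m|.
  have [/= /andP[ls0 ls1] _] := lyapunov_decrease w0 gap_gt0 sm mt.
  rewrite /drift_sum normrM; apply: ler_wpM2l => //.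
  by rewrite ger0_norm; move: ls0 ls1; arith_context; lra.
have pw B : potential B <= (1 - z / 2) * potential A + 2 * cap * (off_sum B)%:R
    + 2 * cap * (off_diff B)%:R.
  have zV : 0 <= (1 - z / 2) * potential A by apply: mulr_ge0; move: z0 z1 Veps eps0; arith_context; lra.
  have V2 := potential_le2 B.
  case: (boolP (off_diff B)) => [bad|ok] /=.
    have : 0 <= 2 * cap * (off_sum B)%:R by apply: mulr_ge0; [move: c0; arith_context; lra | exact: ler0n].
    by rewrite mulr1; move: V2 zV; arith_context; lra.
  case: (boolP (off_sum B)) => [bad|]; rewrite /= ?mulr1 ?mulr0 ?addr0.
    by move: V2 zV; arith_context; lra.
  rewrite /off_sum -ltNge => ok'.
  have nd := next_disparity ok.
  have h := mean_sum_drift n_gt0 q_gt0 q_le_p goodG A.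
  rewrite -/P -/s -/m -/w in h.
  have s'_ge : (1 - z / 4) * `|drift_sum w s m| <= `|bias R B|.
    have h1 : `|drift_sum w s m| <= `|bias R B| + (`|bias R B - mean_sum P| +
        `|mean_sum P - drift_sum w s m|).
      have {1}-> : drift_sum w s m = bias R B -
          ((bias R B - mean_sum P) + (mean_sum P - drift_sum w s m)) by ring.
      by apply: le_trans (ler_normB _ _) _; rewrite lerD2l ler_normD.
    have h2 : tau * (`|s| / 2) <= tau * `|drift_sum w s m| by apply: ler_wpM2l => //; move: tau0; arith_context; lra.
    by move: h2; rewrite -/tau; move: h1 h ok' drift_tau; arith_context; lra.
  have s'_neq0 : bias R B != 0.
    rewrite -normr_gt0; apply: lt_le_trans s'_ge.
    by apply: mulr_gt0; move: z0 z1 half as0; arith_context; lra.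
  have mt' := trap_next mt ok.
  have h3 := lyap_le_ratio cap mt' s'_neq0.
  apply: (le_trans h3); rewrite VA.
  have e2 : 0 <= 2 * e1 <= 1.
    by have := gap_le1 w0 gap_gt0; move: e10 e1g; rewrite -/e1 -/w -/gam; arith_context; lra.
  apply: (ratio_contract w0 gap_gt0 _ _ sm mt s_eps s_neq0 s'_ge nd e2 e1k) => //.
  by move: eps1; arith_context; lra.
apply: le_trans (bern_exp_le_events P01 pw) _.
have h : 2 * cap * bern_pr P off_diff <= z * eps / 8.
  by apply: le_trans small; apply: ler_wpM2l; [move: c0; arith_context; lra | exact: off_diff_pr].
have h2 : z * eps / 8 <= z / 8 * potential A.
  have -> : z * eps / 8 = z / 8 * eps by ring.
  by apply: ler_wpM2l => //; move: z0; arith_context; lra.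
move: h h2 off_sum_pr; arith_context; lra.
Qed.

Let w_lt : w <= 2 / 3.
Proof. by have g0 := gap_gt0; have w0' := w0; move: g0; rewrite -/w /gap; nra. Qed.

(** Most vertices see a fraction of opinion 1 bounded away from 0 and 1, hence
    take part in the anticoncentration of the bias; jumping out of the core halves
    the potential. *)
Lemma contract_core : m ^+ 2 <= trap w -> s ^+ 2 * (cap + 1) <= 1 + kap * m ^+ 2 ->
  10 * drift_error p q <= Num.sqrt n%:R -> (1 + kap) / cap <= 1 / 900 ->
  (core_dev p q + 4) / Num.sqrt n%:R <= 1 / 100 / 2 -> tail_bound <= core_escape p q / 16 ->
  bern_exp P potential <= (1 - core_escape p q / 4) * potential A.
Proof.
move=> mt capped root_large cap_large dev_small small.
have g0 : 0 < gam := gap_gt0.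
have k12 : 12 <= kap := kappa_ge12 w0 gap_gt0.
have th0 := cap_slope_gt0 q_gt0 q_le_p p_le1 gap_gt0.
have B1 := drift_error_ge1 q_gt0 q_le_p p_le1.
have c0 := cap0; have n0 := nR0; have sm : `|s| + `|m| <= 1 := sm1 A.
have L0 := core_dev_ge0 q_gt0 q_le_p p_le1.
have r0 : 0 < Num.sqrt n%:R :> R by rewrite sqrtr_gt0.
have rr : Num.sqrt n%:R ^+ 2 = n%:R :> R by rewrite sqr_sqrtr ?(ltW n0).
set r : R := Num.sqrt n%:R in root_large dev_small r0 rr.
have reach2 : core_reach p q ^+ 2 = 2 * (1 + kap) / cap_slope p q.
  by rewrite sqr_sqrtr //; apply: divr_ge0; [rewrite -/w -/kap; lra | exact: ltW].
have reach0 : 0 <= core_reach p q by apply: sqrtr_ge0.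
have VA : potential A = cap by rewrite /potential /lyap ifT // ifT.
have m1 : m ^+ 2 <= 1 by have := trap_lt1 w0 gap_gt0; lra.
have reach_cap : core_reach p q ^+ 2 / n%:R = 2 * ((1 + kap) / cap).
  by rewrite reach2 /cap; field; rewrite !gt_eqF.
have s2 : s ^+ 2 <= (1 + kap) / cap.
  rewrite ler_pdivlMr //.
  have : kap * m ^+ 2 <= kap * 1 by apply: ler_wpM2l => //; lra.
  by have := sqr_ge0 s; lra.
have s_reach : `|s| <= core_reach p q / r.
  have h : `|s| ^+ 2 <= (core_reach p q / r) ^+ 2.
    rewrite (real_normK (num_real s)) expr_div_n rr reach_cap.
    have : 0 <= (1 + kap) / cap by apply: divr_ge0; move: k12 c0; arith_context; lra.
    by move: s2; arith_context; lra.
  by move: h; rewrite ler_pXn2r ?nnegrE // divr_ge0 // ltW.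
have s30 : `|s| <= 1 / 30.
  have h : `|s| ^+ 2 <= (1 / 30) ^+ 2 by rewrite (real_normK (num_real s)); lra.
  by move: h; rewrite ler_pXn2r ?nnegrE //; lra.
(* The vertices whose sampling chance is close to the field of their block;
   the field itself lies between 0.15 and 0.85, as w <= 2 / 3. *)
pose D := [set v | `|sample_in_pr R G A v - field w A v| <= 1 / 20]%SET.
have nD : (n <= #|D|)%N.
  have bad : #|finset.setC D|%:R * (1 / 20) <= 52 * r / (p + q).
    apply: le_trans (sum_sample_in_pr_field n_gt0 q_gt0 q_le_p goodG A).
    rewrite mulr_natl -sumr_const big_mkcond; apply: ler_sum => v _ /=.
    by rewrite !inE; case: (leP _ (1 / 20)) => //= /ltW.
  have e : 52 * r / (p + q) = drift_error p q * r / 2.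
    by rewrite /drift_error; have := q_gt0; have := q_le_p => qp q0; field; lra.
  have : #|finset.setC D|%:R <= n%:R :> R.
    have : 10 * drift_error p q * r <= r * r by rewrite ler_wpM2r // ltW.
    by rewrite -expr2 rr; rewrite e in bad; move: bad; arith_context; lra.
  rewrite ler_nat => h; have := cardsC D; rewrite card_prod card_bool card_ord.
  by move: h; rewrite mul2n -addnn => h /eqP e2; rewrite -(leq_add2r #|~: D|) (eqP e2) leq_add2l.
have PD v : v \in D -> 1 / 100 <= P v <= 1 - 1 / 100.
  rewrite inE => near_field.
  have sw : `|block_sign R v * w * m| <= 2 / 3.
    rewrite (normrM (_ * w) m) (normrM (block_sign R v) w) (ger0_norm w0).
    have -> : `|block_sign R v| = 1 by rewrite /block_sign; case: ifP; rewrite ?normrN normr1.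
    rewrite mul1r.
    have am1 : `|m| <= 1 by have := normr_ge0 s; lra.
    have h : w * `|m| <= w * 1 by apply: ler_wpM2l.
    by have wl := w_lt; lra.
  have x01 := sample_in_pr01 R G A v.
  move: near_field s30 sw x01; rewrite /field -/s -/m !ler_norml /P /adopt1_pr.
  by set X := sample_in_pr R G A v; arith_context; case: ifP => _ /andP[a1 a2] /andP[b1 b2] /andP[d1 d2] _; nra.
pose jump B := core_dev p q * r <= bern_dev P (fun=> 1) B.
have jump_pr : core_escape p q <= bern_pr P jump.
  apply: (bern_anticoncentration n_gt0 (D := D)) => //.
  by rewrite card_prod card_bool card_ord.
have pw B : potential B <= cap + (- (cap / 2)) * (jump B)%:R + 2 * cap * (off_diff B)%:R.
  have V2 := potential_le2 B.
  case: (boolP (off_diff B)) => [bad|ok]; rewrite /= ?mulr1 ?mulr0 ?addr0.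
    by case: (jump B); rewrite /= ?mulr1 ?mulr0; move: V2 c0; arith_context; lra.
  have mt' := trap_next mt ok.
  have Vcap : potential B <= cap by apply: (lyap_le_cap w0 gap_gt0) => //; exact: ltW.
  case: (boolP (jump B)) => [far|_]; rewrite /= ?mulr1 ?mulr0 ?addr0 //.
  have h := mean_sum_drift n_gt0 q_gt0 q_le_p goodG A.
  rewrite -/P -/s -/m -/w -/r in h.
  have ds : `|drift_sum w s m| <= 3 / 2 * (core_reach p q / r).
    have [/= /andP[ls0 ls1] _] := lyapunov_decrease w0 gap_gt0 sm mt.
    rewrite /drift_sum normrM mulrC; apply: ler_pM => //.
    by rewrite ger0_norm; move: ls0 ls1; arith_context; lra.
  have devE : bias R B - mean_sum P = bern_dev P (fun=> 1) B / n%:R.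
    rewrite mean_sum_dev /bern_dev mulr_suml; apply: eq_bigr => v _.
    by rewrite mul1r mulrC.
  have dev_ge : core_dev p q / r <= bias R B - mean_sum P.
    rewrite devE ler_pdivlMr // -rr -mulrA.
    have -> : r^-1 * r ^+ 2 = r by field; rewrite gt_eqF.
    by [].
  have s'_ge : core_reach p q / r <= bias R B.
    have e : core_dev p q / r = 5 / 2 * (core_reach p q / r) + drift_error p q / r.
      by rewrite /core_dev; field; rewrite gt_eqF.
    by move: h ds; rewrite !ler_norml; move: dev_ge e; arith_context; lra.
  have rk : 0 < core_reach p q ^+ 2 by rewrite reach2; apply: divr_gt0 => //; move: k12; arith_context; lra.
  have reach_gt0 : 0 < core_reach p q by rewrite lt_neqAle reach0 eq_sym andbT; have := rk; rewrite exprn_even_gt0.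
  have s'0 : 0 < bias R B by apply: lt_le_trans s'_ge; exact: divr_gt0.
  have s'2 : 2 * ((1 + kap) / cap) <= bias R B ^+ 2.
    rewrite -reach_cap -rr -expr_div_n ler_pXn2r ?nnegrE // ?ltW //.
    exact: divr_gt0.
  have h3 := lyap_le_ratio cap mt' (lt0r_neq0 s'0).
  apply: (le_trans h3).
  have m1' : disparity R B ^+ 2 <= 1 by have := trap_lt1 w0 gap_gt0; move: mt'; arith_context; lra.
  have km' : kap * disparity R B ^+ 2 <= kap * 1 by apply: ler_wpM2l => //; move: k12; arith_context; lra.
  have : (1 + kap * disparity R B ^+ 2) / bias R B ^+ 2 <= cap / 2.
    rewrite ler_pdivrMr ?exprn_gt0 //.
    have h4 := ler_wpM2l (ltW c0) s'2.
    have e : cap * (2 * ((1 + kap) / cap)) = 2 * (1 + kap) by field; rewrite gt_eqF.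
    by rewrite e in h4; move: h4 km'; arith_context; lra.
  by rewrite -/kap; move: c0; arith_context; lra.
have ce0 : 0 <= cap * core_escape p q.
  apply: mulr_ge0; first exact: ltW.
  by apply: divr_ge0 => //; apply: mulr_ge0 => //; exact: expR_ge0.
have h1 : cap * core_escape p q <= cap * bern_pr P jump by apply: ler_wpM2l => //; exact: ltW.
have h2 : cap * bern_pr P off_diff <= cap * (core_escape p q / 16).
  by apply: ler_wpM2l; [exact: ltW | exact: le_trans off_diff_pr small].
apply: le_trans (bern_exp_le_events P01 pw) _; rewrite VA; move: ce0 h1 h2; arith_context; lra.
Qed.

(** If opinion 1 is held by a fraction u of a block size, a vertex samples it
    with chance at most 2 u / q, by the lower bound on degrees.  So the vertices
    without it gain O(u^2 n), and those with it keep it with chance O(u). *)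
Lemma contract_end : s <= - (1 - eps) -> A != finset.set0 -> 1 <= cap ->
  4 * cap * n%:R * expR (- ((1 / 4) ^+ 2 / 16 * n%:R)) <= 1 / 4 ->
  bern_exp P potential <= 3 / 4 * potential A.
Proof.
move=> s_end A_neq0 cap1 small.
have /andP[eps0 eps1] := end_width_bounds q_gt0 q_le_p p_le1 gap_gt0.
have k12 : 12 <= kap := kappa_ge12 w0 gap_gt0.
have n0 := nR0; have c0 := cap0; have q0 := q_gt0.
have q1 : q <= 1 by apply: le_trans p_le1.
rewrite -/eps in eps0 eps1.
pose u := 1 + s.
have u_eps : u <= eps by rewrite /u; lra.
have cardA : #|A|%:R = u * n%:R.
  by rewrite /u /s bias_card addrC subrK mulfVK ?gt_eqF.
have u_ge : n%:R^-1 <= u.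
  rewrite -(@ler_pM2r _ n%:R) // mulVf ?gt_eqF // -cardA ler1n card_gt0.
  exact: A_neq0.
have u0 : 0 < u by apply: lt_le_trans u_ge; rewrite invr_gt0.
have VA : u <= potential A.
  apply: le_trans (lyap_ge w0 gap_gt0 m (ltW cap0) _); last first.
    by have := sm1 A; have := normr_ge0 (disparity R A); lra.
  rewrite le_min; apply/andP; split; first by rewrite -/cap; lra.
  by rewrite -/s /u in u0 u_eps *; nra.
have X_le v : sample_in_pr R G A v <= 2 * u / q.
  rewrite (sample_in_prE n_gt0 q_gt0 goodG) ler_pdivrMr; last exact: (degree_gt0 n_gt0 q_gt0 goodG).
  have dA : degree_in R G A v <= u * n%:R.
    by rewrite -cardA ler_nat subset_leq_card ?finset.subsetIr.
  have [_ /(_ v) dV] := goodG.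
  apply: (le_trans dA).
  have -> : u * n%:R = 2 * u / q * (q * n%:R / 2) by field; rewrite gt_eqF.
  by apply: ler_wpM2l => //; apply: divr_ge0; lra.
have P_le v : P v <= 4 * u ^+ 2 / q ^+ 2 + 4 * u / q * opinion R A v.
  have /andP[X0 X1] := sample_in_pr01 R G A v.
  have Xv := X_le v.
  have h : sample_in_pr R G A v ^+ 2 <= 4 * u ^+ 2 / q ^+ 2.
    have -> : 4 * u ^+ 2 / q ^+ 2 = (2 * u / q) ^+ 2 by field; rewrite gt_eqF.
    by rewrite ler_pXn2r ?nnegrE //; apply: le_trans Xv.
  have h2 : 4 * u / q = 2 * (2 * u / q) by field; rewrite gt_eqF.
  rewrite /P /adopt1_pr /opinion; case: (v \in A) => /=; last by rewrite mulr0 addr0.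
  have := sqr_ge0 (sample_in_pr R G A v); rewrite mulr1 h2.
  by have : 0 <= 4 * u ^+ 2 / q ^+ 2 by [apply: le_trans h; exact: sqr_ge0]; nra.
have next_small : 1 + mean_sum P <= 12 * eps / q ^+ 2 * u.
  rewrite /mean_sum addrC subrK ler_pdivrMr //.
  apply: (le_trans (ler_sum _ (fun v _ => P_le v))).
  rewrite big_split /= sumr_const -mulr_sumr card_prod card_bool card_ord.
  have -> : \sum_v opinion R A v = u * n%:R.
    rewrite -cardA -sum1_card natr_sum [RHS]big_mkcond; apply: eq_bigr => v _.
    by rewrite /opinion; case: (v \in A).
  rewrite -[X in X + _]mulr_natl natrM.
  have -> : 2 * n%:R * (4 * u ^+ 2 / q ^+ 2) + 4 * u / q * (u * n%:R) =
    (8 + 4 * q) / q ^+ 2 * u * (u * n%:R) by field; rewrite gt_eqF.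
  have -> : 12 * eps / q ^+ 2 * u * n%:R = 12 / q ^+ 2 * eps * (u * n%:R) by ring.
  apply: ler_wpM2r; first by apply: mulr_ge0; exact: ltW.
  apply: ler_pM => //; [by apply: divr_ge0; [lra | exact: sqr_ge0] | exact: ltW |].
  by rewrite ler_pM2r ?invr_gt0 ?exprn_gt0 //; lra.
pose far B := 1 / 4 <= `|bias R B - mean_sum P|.
have far_pr : bern_pr P far <= 2 * expR (- ((1 / 4) ^+ 2 / 16 * n%:R)).
  by apply: bias_concentration => //; lra.
have eps_k : (8 + 4 * kap) * (12 * eps / q ^+ 2) = 1 / 2.
  rewrite /eps /end_width -/w -/kap; field; apply/andP; split; rewrite gt_eqF //; lra.
have mean_quarter : 1 + mean_sum P <= 1 / 4.
  apply: (le_trans next_small).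
  have : 12 * eps / q ^+ 2 <= 1 / 4.
    have : 0 <= 12 * eps / q ^+ 2 by apply: divr_ge0; [lra | exact: sqr_ge0].
    by nra.
  by nra.
have pw B : potential B <= (8 + 4 * kap) * (1 + bias R B) + 2 * cap * (far B)%:R.
  have V2 := potential_le2 B.
  have smB := sm1 B.
  have s'1 : 0 <= 1 + bias R B.
    have := ler_norm (- bias R B); rewrite normrN.
    by have := normr_ge0 (disparity R B); lra.
  have r0 : 0 <= (8 + 4 * kap) * (1 + bias R B) by apply: mulr_ge0; move: k12 s'1; arith_context; lra.
  case: (boolP (far B)) => [_|]; rewrite /= ?mulr1 ?mulr0 ?addr0.
    by lra.
  rewrite /far -ltNge ltr_norml => /andP[_ close].
  have s'_half : bias R B <= - (1 / 2) by lra.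
  have s'_abs : `|bias R B| = - bias R B by rewrite ler0_norm //; lra.
  have m' : `|disparity R B| <= 1 + bias R B by move: smB; rewrite s'_abs; lra.
  have m0 := normr_ge0 (disparity R B).
  have mm : disparity R B ^+ 2 <= 1 / 2 * (1 + bias R B).
    rewrite -(real_normK (num_real (disparity R B))).
    by move: m' m0 s'_half; arith_context; nra.
  have mt : disparity R B ^+ 2 <= trap w by have := trap_ge_half w0 gap_gt0; move: mm s'_half; arith_context; lra.
  have s'0 : bias R B != 0 by rewrite lt_eqF //; move: s'_half; arith_context; lra.
  apply: (le_trans (lyap_le_ratio cap mt s'0)).
  have S' : 1 / 4 <= bias R B ^+ 2 by move: s'_half; arith_context; nra.
  rewrite lerBlDr ler_pdivrMr; last by move: S'; arith_context; lra.
  have km : kap * disparity R B ^+ 2 <= kap * (1 / 2 * (1 + bias R B)).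
    by apply: ler_wpM2l => //; move: k12; arith_context; lra.
  rewrite -/kap.
  have := ler_wpM2l r0 S'; move: km k12 s'1; arith_context; nra.
have -> : 3 / 4 * potential A = 1 / 2 * potential A + 1 / 4 * potential A by lra.
apply: le_trans (le_bern_exp P01 pw) _.
rewrite bern_expD !bern_expZ bern_exp_bias //.
apply: lerD.
  have k0 : 0 <= 8 + 4 * kap by lra.
  apply: (le_trans (ler_wpM2l k0 next_small)); rewrite mulrA eps_k.
  by apply: ler_wpM2l.
have c20 : 0 <= 2 * cap by lra.
apply: (le_trans (ler_wpM2l c20 far_pr)).
apply: (@le_trans _ _ (1 / 4 * n%:R^-1)); last by apply: ler_wpM2l => //; exact: le_trans VA.
rewrite ler_pdivlMr //; move: small; set E := expR _ => small.
by have -> : 2 * cap * (2 * E) * n%:R = 4 * cap * n%:R * E by ring.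
Qed.

End OneStepContraction.

(** * Contraction for all large block sizes *)

Section Potential.
Variables (R : realType) (n : nat) (p q : R).
Hypothesis n_gt0 : (0 < n)%N.
Hypotheses (q_gt0 : 0 < q) (q_le_p : q <= p) (p_le1 : p <= 1).
Hypothesis gap_gt0 : 0 < gap (contrast p q).
Implicit Type A : {set vertex n}.

Let nR0 : 0 < n%:R :> R. Proof. by rewrite ltr0n. Qed.
Let w0 : 0 <= contrast p q. Proof. by have /andP[] := contrast01 q_gt0 q_le_p. Qed.
Let cap0 : 0 < cap_slope p q * n%:R.
Proof. by apply: mulr_gt0 => //; exact: cap_slope_gt0. Qed.

Lemma potentialC A : potential p q (finset.setC A) = potential p q A.
Proof. by rewrite /potential biasC // disparityC lyapN. Qed.

Lemma potential_consensus A : consensus A -> potential p q A = 0.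
Proof.
have n0 := nR0.
have b0 : bias R (finset.set0 : {set vertex n}) = -1.
  by rewrite bias_card cards0 mul0r sub0r.
have V0 : potential p q (finset.set0 : {set vertex n}) = 0.
  have d0 : disparity R (finset.set0 : {set vertex n}) = 0.
    rewrite /disparity /mean_diff big1 ?mul0r // => v _.
    by rewrite /opinion finset.in_set0 mulr0.
  rewrite /potential /lyap b0 d0 expr0n /= sqrrN expr1n ifT; last first.
    by have := trap_ge_half w0 gap_gt0; lra.
  by rewrite ifN; [rewrite mulr0 addr0 divr1 subrr | rewrite -ltNge; have := cap0; lra].
by case=> -> //; rewrite -finset.setC0 potentialC.
Qed.

(** One vertex of the minority opinion already gives 1 - |s| >= 1 / n. *)
Lemma potential_bounds A : ~ consensus A -> 1 <= cap_slope p q * n%:R ->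
  n%:R^-1 <= potential p q A <= 2 * (cap_slope p q * n%:R).
Proof.
move=> ncons cap1; have n0 := nR0.
have sm := bias_disparity_le1 R n_gt0 A.
have m0 := normr_ge0 (disparity R A); have s0 := normr_ge0 (bias R A).
have n1 : n%:R^-1 <= 1 :> R by rewrite invf_le1 // ler1n.
apply/andP; split; last by apply: lyap_le2 => //; [exact: ltW | lra].
apply: le_trans (lyap_ge w0 gap_gt0 (disparity R A) (ltW cap0) _); last by lra.
rewrite le_min; apply/andP; split; first exact: le_trans cap1.
have card_ge1 (B : {set vertex n}) : B != finset.set0 -> 1 / n%:R <= 1 + bias R B.
  move=> B0; rewrite bias_card addrC subrK ler_pM2r ?invr_gt0 //.
  by rewrite ler1n card_gt0.
have A0 : A != finset.set0 by apply/eqP => A0; apply: ncons; left.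
have AT : finset.setC A != finset.set0.
  by apply/eqP => A1; apply: ncons; right; rewrite -[A]finset.setCK A1 finset.setC0.
have := card_ge1 _ A0; have := card_ge1 _ AT; rewrite biasC // !mul1r => h1 h2.
have : n%:R^-1 <= 1 - `|bias R A| by case: (ler0P (bias R A)) => _; lra.
by rewrite -(real_normK (num_real (bias R A))); nra.
Qed.

End Potential.

Local Open Scope classical_set_scope.
Local Open Scope ring_scope.

Lemma near_ge_sqrt (R : realType) (K : R) :
  \forall n \near \oo, K <= Num.sqrt n%:R.
Proof.
near=> n; have h : K ^+ 2 <= n%:R by near: n; exact: nbhs_infty_ger.
apply: le_trans (ler_norm K) _; rewrite -sqrtr_sqr; exact: ler_wsqrtr.
Unshelve. all: by end_near. Qed.

Lemma near_sqr_expRN (R : realType) (a d : R) : 0 < a -> 0 < d ->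
  \forall n \near \oo, n%:R ^+ 2 * expR (- (a * n%:R)) <= d.
Proof.
move=> a0 d0; near=> n.
have n0 : 0 < n%:R :> R by rewrite ltr0n; near: n; exact: nbhs_infty_gt.
have h : 6 / a ^+ 3 / d <= n%:R by near: n; exact: nbhs_infty_ger.
apply: (@le_trans _ _ (n%:R ^+ 2 * (6 / (a * n%:R) ^+ 3))).
  by apply: ler_wpM2l; [exact: sqr_ge0 | apply: expRN_cube_le; exact: mulr_gt0].
have -> : n%:R ^+ 2 * (6 / (a * n%:R) ^+ 3) = 6 / a ^+ 3 / n%:R.
  by field; rewrite !gt_eqF.
by rewrite ler_pdivrMr // [d * _]mulrC -ler_pdivrMr.
Unshelve. all: by end_near. Qed.

Section Contraction.
Variables (R : realType) (p q : R).
Hypotheses (q_gt0 : 0 < q) (q_le_p : q <= p) (p_le1 : p <= 1).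
Hypothesis gap_gt0 : 0 < gap (contrast p q).

Let w0 : 0 <= contrast p q. Proof. by have /andP[] := contrast01 q_gt0 q_le_p. Qed.

Definition contraction_rate : R :=
  Num.min (Num.min (gap (contrast p q) / 96) (core_escape p q / 4))
          (Num.min (mid_rate p q / 4) (1 / 4)).

Let rate_le :
  [/\ contraction_rate <= gap (contrast p q) / 96,
      contraction_rate <= core_escape p q / 4,
      contraction_rate <= mid_rate p q / 4 & contraction_rate <= 1 / 4].
Proof. by split; rewrite !ge_min lexx ?orbT. Qed.

Lemma core_escape_gt0 : 0 < core_escape p q.
Proof. by apply: divr_gt0 => //; apply: mulr_gt0 => //; exact: expR_gt0. Qed.

Lemma contraction_rate_bounds : 0 < contraction_rate <= 1.
Proof.
have [_ _ _ h] := rate_le; apply/andP; split; last by lra.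
have /andP[z0 _] := mid_rate_bounds q_gt0 q_le_p p_le1 gap_gt0.
have c0 := core_escape_gt0; have g0 := gap_gt0.
by rewrite !lt_min; lra.
Qed.

(** The four regimes together.  Close to consensus, exchanging the opinions
    reduces to the case where opinion 1 is in the minority. *)
Lemma step_potential_le (n : nat) (G : graph (vertex n)) :
  (0 < n)%N -> good_graph p q G ->
  drift_error p q / Num.sqrt n%:R <= noise_level p q ->
  1 <= cap_slope p q * n%:R ->
  (1 + kappa (contrast p q)) / (cap_slope p q * n%:R) <= 1 / 900 ->
  10 * drift_error p q <= Num.sqrt n%:R ->
  (core_dev p q + 4) / Num.sqrt n%:R <= 1 / 100 / 2 ->
  4 * (cap_slope p q * n%:R) * n%:R *
    expR (- ((1 / 4) ^+ 2 / 16 * n%:R)) <= 1 / 4 ->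
  tail_bound n p q <= gap (contrast p q) / 192 ->
  tail_bound n p q <= core_escape p q / 16 ->
  2 * (cap_slope p q * n%:R) * tail_bound n p q <=
    mid_rate p q * end_width p q / 8 ->
  forall A, step G (potential p q) A <= (1 - contraction_rate) * potential p q A.
Proof.
move=> n_gt0 goodG drift_small cap1 cap_large root_large dev_small end_small
  out_small core_small mid_small A.
have [b1 b2 b3 b4] := rate_le.
have weaken (c : R) : contraction_rate <= c -> forall B : {set vertex n},
    step G (potential p q) B <= (1 - c) * potential p q B ->
    step G (potential p q) B <= (1 - contraction_rate) * potential p q B.
  move=> bc B; have [cB _|nB] := pselect (consensus B).
    by rewrite step_consensus // potential_consensus // mulr0.
  have /andP[VB _] := potential_bounds n_gt0 q_gt0 q_le_p p_le1 gap_gt0 nB cap1.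
  move=> h; apply: (le_trans h); apply: ler_wpM2r.
    by apply: le_trans VB; rewrite invr_ge0 ler0n.
  by rewrite lerD2l lerN2.
have end_case (B : {set vertex n}) : B != finset.set0 ->
    bias R B <= - (1 - end_width p q) ->
    step G (potential p q) B <= (1 - contraction_rate) * potential p q B.
  move=> B0 bB; apply: (weaken _ b4).
  rewrite step_bern_exp (_ : 1 - 1 / 4 = 3 / 4); last by lra.
  exact: contract_end.
have [cA|nA] := pselect (consensus A).
  by rewrite step_consensus // potential_consensus // mulr0.
have [trapped|out] := leP (disparity R A ^+ 2) (trap (contrast p q)); last first.
  by apply: (weaken _ b1); rewrite step_bern_exp; apply: contract_outside.
have [capped|uncapped] := leP (bias R A ^+ 2 * (cap_slope p q * n%:R + 1))
    (1 + kappa (contrast p q) * disparity R A ^+ 2).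
  by apply: (weaken _ b2); rewrite step_bern_exp; apply: contract_core.
have [mid|far] := leP (`|bias R A|) (1 - end_width p q).
  by apply: (weaken _ b3); rewrite step_bern_exp; apply: contract_middle.
have [neg|pos] := leP (bias R A) 0.
  apply: end_case; first by apply/eqP => A0; apply: nA; left.
  by rewrite lerNr -(ler0_norm neg) ltW.
rewrite -potentialC // -[A in step _ _ A]finset.setCK stepC.
rewrite (_ : (fun B => potential p q (finset.setC B)) = potential p q); last first.
  by apply/funext => B; rewrite potentialC.
apply: end_case.
  by apply/eqP => A0; apply: nA; right; rewrite -[A]finset.setCK A0 finset.setC0.
by rewrite biasC // lerN2 -(gtr0_norm pos) ltW.
Qed.

Lemma near_step_potential_le : \forall n \near \oo,
  forall (G : graph (vertex n)), good_graph p q G ->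
  forall A, step G (potential p q) A <= (1 - contraction_rate) * potential p q A.
Proof.
have g0 := gap_gt0; have ce0 := core_escape_gt0.
have /andP[z0 _] := mid_rate_bounds q_gt0 q_le_p p_le1 gap_gt0.
have /andP[eps0 _] := end_width_bounds q_gt0 q_le_p p_le1 gap_gt0.
have th0 := cap_slope_gt0 q_gt0 q_le_p p_le1 gap_gt0.
have [e10 _ _] := noise_level_bounds q_gt0 q_le_p p_le1 gap_gt0.
have c40 : 0 < 4 * cap_slope p q by lra.
pose a := noise_level p q ^+ 2 / 16.
have a0 : 0 < a by apply: divr_gt0 => //; exact: exprn_gt0.
pose d_out := gap (contrast p q) / 192 / 2.
pose d_core := core_escape p q / 16 / 2.
pose d_mid := mid_rate p q * end_width p q / 8 / (4 * cap_slope p q).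
have d_out0 : 0 < d_out by rewrite /d_out; lra.
have d_core0 : 0 < d_core by rewrite /d_core; lra.
have d_mid0 : 0 < d_mid.
  by apply: divr_gt0 => //; apply: divr_gt0 => //; exact: mulr_gt0.
have b0 : 0 < (1 / 4) ^+ 2 / 16 :> R by lra.
have d_end0 : 0 < 1 / 4 / (4 * cap_slope p q) by apply: divr_gt0 => //; lra.
have tail_le (n : nat) (d : R) : (0 < n)%N ->
    n%:R ^+ 2 * expR (- (a * n%:R)) <= d -> tail_bound n p q <= 2 * d.
  move=> n0 h; rewrite /tail_bound -/a; apply: ler_wpM2l => //.
  by apply: le_trans h; rewrite ler_peMl ?expR_ge0 // exprn_ege1 // ler1n.
near=> n => G goodG.
have n_gt0 : (0 < n)%N by near: n; exact: nbhs_infty_gt.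
have n0 : 0 < n%:R :> R by rewrite ltr0n.
have r0 : 0 < Num.sqrt n%:R :> R by rewrite sqrtr_gt0.
have n1 : 1 <= n%:R :> R by rewrite ler1n.
have cap0 : 0 < cap_slope p q * n%:R by exact: mulr_gt0.
apply: step_potential_le => //.
- rewrite ler_pdivrMr // [_ * Num.sqrt _]mulrC -ler_pdivrMr //.
  by near: n; exact: near_ge_sqrt.
- by rewrite mulrC -ler_pdivrMr //; near: n; exact: nbhs_infty_ger.
- have : (1 + kappa (contrast p q)) * 900 / cap_slope p q <= n%:R.
    by near: n; exact: nbhs_infty_ger.
  rewrite (ler_pdivrMr _ _ th0) (ler_pdivrMr _ _ cap0); lra.
- by near: n; exact: near_ge_sqrt.
- rewrite ler_pdivrMr // [_ * Num.sqrt _]mulrC -ler_pdivrMr; last by lra.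
  by near: n; exact: near_ge_sqrt.
- have h : n%:R ^+ 2 * expR (- ((1 / 4) ^+ 2 / 16 * n%:R)) <= 1 / 4 / (4 * cap_slope p q).
    by near: n; exact: near_sqr_expRN.
  move: h; rewrite (ler_pdivlMr _ _ c40); set E := expR _.
  have -> : n%:R ^+ 2 * E * (4 * cap_slope p q) = 4 * (cap_slope p q * n%:R) * n%:R * E by ring.
  by [].
- rewrite -[leRHS](@divfK _ 2) // [leRHS]mulrC; apply: tail_le => //.
  by near: n; exact: near_sqr_expRN.
- rewrite -[leRHS](@divfK _ 2) // [leRHS]mulrC; apply: tail_le => //.
  by near: n; exact: near_sqr_expRN.
- have h : n%:R ^+ 2 * expR (- (a * n%:R)) <= d_mid by near: n; exact: near_sqr_expRN.
  have h2 : n%:R * expR (- (a * n%:R)) <= d_mid.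
    apply: le_trans h; set E := expR _.
    have E0 : 0 <= n%:R * E by apply: mulr_ge0; [exact: ltW | exact: expR_ge0].
    have -> : n%:R ^+ 2 * E = n%:R * (n%:R * E) by ring.
    exact: ler_peMl.
  move: h2; rewrite /d_mid (ler_pdivlMr _ _ c40) /tail_bound -/a; set E := expR _.
  have -> : n%:R * E * (4 * cap_slope p q) = 2 * (cap_slope p q * n%:R) * (2 * E) by ring.
  by [].
Unshelve. all: by end_near. Qed.

End Contraction.

(** * Consensus time *)

(** With r = q / p, the gap is positive exactly when (r + 2)^2 > 5. *)
Lemma gap_contrast_gt0 (R : realType) (p q : R) : 0 < q -> q <= p ->
  Num.sqrt 5 - 2 < q / p -> 0 < gap (contrast p q).
Proof.
move=> q0 qp h; have p0 : 0 < p by lra.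
have sq0 : 0 <= Num.sqrt 5 :> R by exact: sqrtr_ge0.
have sq5 : Num.sqrt 5 ^+ 2 = 5 :> R by rewrite sqr_sqrtr.
have h2 : Num.sqrt 5 * p < q + 2 * p.
  by move: h; rewrite ltr_pdivlMr //; lra.
have h3 : 5 * p ^+ 2 < (q + 2 * p) ^+ 2.
  by rewrite -sq5 -exprMn ltr_pXn2r ?nnegrE ?mulr_ge0 //; lra.
have -> : gap (contrast p q) = ((q + 2 * p) ^+ 2 - 5 * p ^+ 2) / (p + q) ^+ 2.
  by rewrite /gap /contrast; field; lra.
by apply: divr_gt0; [lra | apply: exprn_gt0; lra].
Qed.

Section ConsensusTime.
Variables (R : realType) (p q : R).
Hypotheses (q_gt0 : 0 < q) (q_le_p : q <= p) (p_le1 : p <= 1).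
Hypothesis gap_gt0 : 0 < gap (contrast p q).
Variables (n : nat) (G : graph (vertex n)).
Hypothesis n_gt0 : (0 < n)%N.
Hypothesis cap_ge1 : 1 <= cap_slope p q * n%:R.
Hypothesis contracts : forall A,
  step G (potential p q) A <= (1 - contraction_rate p q) * potential p q A.

(** Markov's inequality, as the potential is at least 1 / n before consensus. *)
Lemma consensus_pr_ge A T :
  1 - 2 * cap_slope p q * n%:R ^+ 2 * (1 - contraction_rate p q) ^+ T <=
  iter T (step G) (fun B => `[< consensus B >]%:R) A.
Proof.
have n0 : 0 < n%:R :> R by rewrite ltr0n.
have /andP[b0 b1] := contraction_rate_bounds q_gt0 q_le_p p_le1 gap_gt0.
have rho0 : 0 <= 1 - contraction_rate p q by lra.
have th0 := cap_slope_gt0 q_gt0 q_le_p p_le1 gap_gt0.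
have pw (B : {set vertex n}) : 1 + - n%:R * potential p q B <= `[< consensus B >]%:R.
  case: asboolP => [cB|nB] /=.
    by rewrite potential_consensus // mulr0 addr0.
  have /andP[VB _] := potential_bounds n_gt0 q_gt0 q_le_p p_le1 gap_gt0 nB cap_ge1.
  by rewrite mulNr subr_le0 -ler_pdivrMl // mulr1.
apply: le_trans (le_iter_step G T A pw); rewrite iter_step_affine.
have VA : potential p q A <= 2 * (cap_slope p q * n%:R).
  have [cA|nA] := pselect (consensus A).
    by have c1 := cap_ge1; rewrite potential_consensus //; lra.
  by have /andP[] := potential_bounds n_gt0 q_gt0 q_le_p p_le1 gap_gt0 nA cap_ge1.
have h := iter_step_contract T A rho0 contracts.
have h2 : (1 - contraction_rate p q) ^+ T * potential p q A <=
    (1 - contraction_rate p q) ^+ T * (2 * (cap_slope p q * n%:R)).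
  by apply: ler_wpM2l => //; exact: exprn_ge0.
have h3 := ler_wpM2l (ltW n0) (le_trans h h2).
rewrite mulNr lerD2l lerN2; apply: (le_trans h3).
rewrite le_eqVlt; apply/orP; left; apply/eqP; ring.
Qed.

End ConsensusTime.

Lemma pow_log_time (R : realType) (b : R) (n : nat) : (0 < n)%N -> 0 < b <= 1 ->
  (1 - b) ^+ Num.truncn (3 / b * ln n%:R) <= expR b / n%:R ^+ 3.
Proof.
move=> n_gt0 /andP[b0 b1].
have n0 : 0 < n%:R :> R by rewrite ltr0n.
set x := 3 / b * ln n%:R.
have x0 : 0 <= x by apply: mulr_ge0; [apply: divr_ge0; lra | rewrite ln_ge0 // ler1n].
apply: (@le_trans _ _ (expR (- b) ^+ Num.truncn x)).
  apply: lerXn2r; rewrite ?nnegrE ?expR_ge0 //; first lra.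
  exact: expR_ge1Dx.
rewrite -expRM_natl.
have -> : expR b / n%:R ^+ 3 = expR (b - b * x).
  rewrite expRD expRN; congr (_ / _).
  have -> : b * x = 3%:R * ln n%:R by rewrite /x; field; lra.
  by rewrite expRM_natl lnK.
rewrite ler_expR; have /andP[_ xT] := truncn_itv x0.
have h := ler_wpM2l (ltW b0) (ltW xT).
by move: h; rewrite -natr1 mulrDr mulr1; lra.
Qed.

Theorem theorem1p5 (R : realType) (p q : R)
    (q_gt0 : 0 < q) (q_le_p : q <= p) (p_le1 : p <= 1)
    (q_over_p : Num.sqrt 5 - 2 < q / p) :
  exists c C C' K : R,
    [/\ 0 < c, 0 < C, 0 < C' & 0 < K] /\
    \forall n \near \oo,
      1 - n%:R `^ (- c) <=
      sbm_pr p q (fun G : graph (vertex n) =>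
        forall (A : {set vertex n}) (d : measure_display)
               (Omega : measurableType d) (P : probability Omega R)
               (S : Omega -> nat -> vertex n -> vertex n * vertex n),
          best_of_two_samples G P S ->
          ((1 - K * n%:R `^ (- C'))%:E <=
           P [set w | (consensus_time R A (S w) <= (C * ln n%:R)%:E)%E])%E).
Proof.
have gap_gt0 := gap_contrast_gt0 q_gt0 q_le_p q_over_p.
have th0 := cap_slope_gt0 q_gt0 q_le_p p_le1 gap_gt0.
have bb := contraction_rate_bounds q_gt0 q_le_p p_le1 gap_gt0.
have /andP[b0 b1] := bb.
set b := contraction_rate p q in bb b0 b1.
(* The initial potential is O(n) and Markov's inequality costs another factor
   n, so the decay n^-3 leaves n^-1. *)
exists 1, (3 / b), 1, (2 * cap_slope p q * expR b); split.
  split=> //; first exact: divr_gt0.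
  by apply: mulr_gt0; [exact: mulr_gt0 | exact: expR_gt0].
near=> n.
have n_gt0 : (0 < n)%N by near: n; exact: nbhs_infty_gt.
have n0 : 0 < n%:R :> R by rewrite ltr0n.
have cap1 : 1 <= cap_slope p q * n%:R.
  by rewrite mulrC -ler_pdivrMr //; near: n; exact: nbhs_infty_ger.
have contracts : forall (G : graph (vertex n)), good_graph p q G ->
    forall A, step G (potential p q) A <= (1 - b) * potential p q A.
  by near: n; exact: near_step_potential_le.
have n_large : 24 * (128 / q ^+ 2) ^+ 3 <= n%:R by near: n; exact: nbhs_infty_ger.
rewrite powR_inv1 ?ler0n //.
apply: le_trans (good_graph_pr n_gt0 q_gt0 q_le_p p_le1 n_large) _.
rewrite !sbm_prE; apply: le_bern_exp; first exact: pair_pr01.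
move=> G; rewrite ler_nat; case: asboolP => // goodG.
rewrite asboolT // => A d Omega P S samplesS.
have x0 : 0 <= 3 / b * ln n%:R.
  by apply: mulr_ge0; [apply: divr_ge0; lra | rewrite ln_ge0 // ler1n].
rewrite (_ : [set w | _] = [set w | (fun B => `[< consensus B >])
    (opinions A (S w) (Num.truncn (3 / b * ln n%:R)))]); last first.
  by apply/funext => w /=; rewrite consensus_time_le.
have [_ ->] := pr_opinions samplesS (fun B => `[< consensus B >]) A
  (Num.truncn (3 / b * ln n%:R)).
rewrite lee_fin.
apply: le_trans (consensus_pr_ge q_gt0 q_le_p p_le1 gap_gt0 n_gt0 cap1 (contracts G goodG) _ _).
rewrite lerD2l lerN2.
rewrite -/b; have := pow_log_time n_gt0 bb; set X := (1 - b) ^+ _ => h.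
have k0 : 0 <= 2 * cap_slope p q * n%:R ^+ 2.
  by apply: mulr_ge0; [lra | exact: sqr_ge0].
have h2 := ler_wpM2l k0 h; apply: (le_trans h2).
have -> : 2 * cap_slope p q * n%:R ^+ 2 * (expR b / n%:R ^+ 3) =
  2 * cap_slope p q * expR b * n%:R^-1 by field; rewrite gt_eqF.
by [].
Unshelve. all: by end_near. Qed.
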